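(* Let $R$ and $S$ be left Noetherian rings that are derived equivalent. Suppose that for every object $M$ of $\mathsf{D}^b(R\text{-mod})$ with $M\perp M$ and $M\perp R$, the object $M$ belongs to $\mathsf{Thick}(R)$. Then for every object $N$ of $\mathsf{D}^b(S\text{-mod})$ with $N\perp N$ and $N\perp S$, the object $N$ belongs to $\mathsf{Thick}(S)$.
   Context: For a left Noetherian ring $R$, $R\text{-mod}$ is the category of finitely generated left $R$-modules and $\mathsf{D}^b(R\text{-mod})$ is its bounded derived category, with shift functor $\Sigma$; $R$ is regarded as a stalk complex in degree $0$. Two rings $R$ and $S$ are derived equivalent if there exists an equivalence of triangulated categories between $\mathsf{D}^b(R\text{-mod})$ and $\mathsf{D}^b(S\text{-mod})$. For objects $X,Y$ of a triangulated category $\mathsf{T}$ with shift $\Sigma$, $X\perp Y$ (''eventually orthogonal'') means that $\operatorname{Hom}_{\mathsf{T}}(X,\Sigma^iY)=0$ for all integers $i$ with $|i|$ sufficiently large (vanishing is not required for all $i\in\mathbb{Z}$). A triangulated subcategory of $\mathsf{T}$ is a non-empty full subcategory closed under all shifts $\Sigma^i$, $i\in\mathbb{Z}$, and such that whenever two of the objects $X,Y,Z$ in a distinguished triangle $X\to Y\to Z\to\Sigma X$ lie in it, so does the third; it is thick if it is also closed under direct summands. $\mathsf{Thick}(R)$ is the intersection of all thick subcategories of $\mathsf{D}^b(R\text{-mod})$ containing $R$, and $\mathsf{Thick}(S)$ is defined likewise in $\mathsf{D}^b(S\text{-mod})$. *)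

(* Defs.v *)
From HB Require Import structures.
From mathcomp Require Import all_boot all_order all_algebra.

Set Implicit Arguments.
Unset Strict Implicit.
Unset Printing Implicit Defensive.

Import GRing.Theory Num.Theory.
Local Open Scope ring_scope.

Definition fin_gen (R : pzRingType) (M : lmodType R) : Prop :=
  exists (n : nat) (g : 'I_n -> M), forall x : M,
    exists c : 'I_n -> R, x = \sum_i c i *: g i.

Record left_ideal (R : pzRingType) (I : R -> Prop) : Prop := LeftIdeal {
  left_ideal0 : I 0;
  left_idealD : forall x y, I x -> I y -> I (x + y);
  left_idealM : forall a x, I x -> I (a * x) }.

Definition left_noetherian (R : pzRingType) : Prop :=
  forall I : R -> Prop, left_ideal I ->
    exists (n : nat) (g : 'I_n -> R), (forall i, I (g i)) /\
      forall x, I x -> exists c : 'I_n -> R, x = \sum_i c i * g i.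

(* Bounded cochain complexes of finitely generated left R-modules.  The
   differential is a family [X i -> X j] that vanishes unless [j = i + 1]; since
   [i + 1 + n] and [i + n + 1] are not convertible, this is what lets the shifts
   be defined without transporting elements along equalities of degrees. *)
Record cplx (R : pzRingType) := Cplx {
  cob :> int -> lmodType R;
  cdf : forall i j, {linear cob i -> cob j};
  cdf_shape : forall i j, j != i + 1 -> forall x, cdf i j x = 0;
  cdf_sq : forall i j k x, cdf j k (cdf i j x) = 0;
  cob_fg : forall i, fin_gen (cob i);
  cob_bounded : exists n : nat, forall i, (n < `|i|)%N ->
    forall x : cob i, x = 0 }.

Record cmap (R : pzRingType) (X Y : cplx R) := Cmap {
  cmf :> forall i, {linear X i -> Y i};
  cmf_d : forall i j x, cmf j (cdf X i j x) = cdf Y i j (cmf i x) }.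

Definition homotopic (R : pzRingType) (X Y : cplx R) (f g : cmap X Y) : Prop :=
  exists h : forall i j, {linear X i -> Y j}, forall i x,
    f i x - g i x
      = cdf Y (i - 1) i (h i (i - 1) x) + h (i + 1) i (cdf X i (i + 1) x).

(* [f] induces an injection and a surjection on [H^i = ker d^i / im d^(i-1)]. *)
Definition quasi_iso (R : pzRingType) (X Y : cplx R) (f : cmap X Y) : Prop :=
  (forall i x, cdf X i (i + 1) x = 0 ->
     (exists y, f i x = cdf Y (i - 1) i y) ->
     exists x', x = cdf X (i - 1) i x') /\
  (forall i y, cdf Y i (i + 1) y = 0 ->
     exists x, cdf X i (i + 1) x = 0 /\
       exists y', f i x - y = cdf Y (i - 1) i y').

Section Modules.
Variable R : pzRingType.

Lemma fin_gen_trivial (M : lmodType R) : (forall x : M, x = 0) -> fin_gen M.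
Proof.
by move=> M0; exists 0%N, (fun=> 0) => x; exists (fun=> 0);
   rewrite (M0 x) big_ord0.
Qed.

Lemma fin_gen_regular : fin_gen (R^o : lmodType R).
Proof.
exists 1%N, (fun=> 1) => x; exists (fun=> x).
by rewrite big_ord1 /GRing.scale /= mulr1.
Qed.

Lemma fin_gen_prod (M N : lmodType R) :
  fin_gen M -> fin_gen N -> fin_gen ((M * N)%type : lmodType R).
Proof.
move=> [m [g gP]] [n [h hP]].
exists (m + n)%N, (fun i => match split i with
  | inl j => (g j, 0) | inr k => (0, h k) end) => -[x y].
have [a ->] := gP x; have [b ->] := hP y.
exists (fun i => match split i with inl j => a j | inr k => b k end).
rewrite big_split_ord /=.
rewrite (eq_bigr (fun i => (a i *: g i, 0 : N))); last first.
  move=> i _; rewrite -[lshift n i]/(unsplit (inl i)) unsplitK.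
  by congr (_, _); rewrite /= scaler0.
rewrite [X in _ = _ + X](eq_bigr (fun i => (0 : M, b i *: h i))); last first.
  move=> i _; rewrite -[rshift m i]/(unsplit (inr i)) unsplitK.
  by congr (_, _); rewrite /= scaler0.
have -> : \sum_i (a i *: g i, 0 : N) = (\sum_i a i *: g i, 0).
  by elim/big_rec2: _ => [//|i u v _ ->]; congr (_, _); rewrite /= add0r.
have -> : \sum_i (0 : M, b i *: h i) = (0, \sum_i b i *: h i).
  by elim/big_rec2: _ => [//|i u v _ ->]; congr (_, _); rewrite /= add0r.
by congr (_, _); rewrite /= ?addr0 ?add0r.
Qed.

End Modules.

Section Cmaps.
Variable R : pzRingType.
Implicit Types X Y Z : cplx R.

Definition cid X : cmap X X :=
  @Cmap R X X (fun i => idfun) (fun i j x => erefl).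

Lemma ccomp_d X Y Z (g : cmap Y Z) (f : cmap X Y) i j x :
  (g j \o f j) (cdf X i j x) = cdf Z i j ((g i \o f i) x).
Proof. by rewrite /= !cmf_d. Qed.

Definition ccomp X Y Z (g : cmap Y Z) (f : cmap X Y) : cmap X Z :=
  @Cmap R X Z (fun i => g i \o f i) (ccomp_d g f).

Lemma czero_d X Y i j (x : X i) : (0 : Y j) = cdf Y i j 0.
Proof. by rewrite linear0. Qed.

Definition czero X Y : cmap X Y :=
  @Cmap R X Y (fun i => \0 : {linear X i -> Y i}) (@czero_d X Y).

End Cmaps.

Section Shift.
Variables (R : pzRingType) (n : int).
Implicit Types X Y Z : cplx R.

Definition shift_d X (i j : int) (x : X (i + n)) : X (j + n) :=
  if odd `|n| then - cdf X (i + n) (j + n) x else cdf X (i + n) (j + n) x.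

Lemma shift_d_linear X (i j : int) : linear (@shift_d X i j).
Proof.
move=> a u v; rewrite /shift_d !linearP.
by case: (odd _); rewrite // opprD scalerN.
Qed.

HB.instance Definition _ X (i j : int) :=
  GRing.isLinear.Build R (X (i + n)) (X (j + n)) _ (@shift_d X i j)
    (@shift_d_linear X i j).

Lemma shift_d_shape X (i j : int) : j != i + 1 ->
  forall x, @shift_d X i j x = 0.
Proof.
move=> ij x; rewrite /shift_d cdf_shape ?oppr0 ?if_same //.
by rewrite addrAC (inj_eq (addIr n)).
Qed.

Lemma shift_d_sq X (i j k : int) x : @shift_d X j k (@shift_d X i j x) = 0.
Proof.
by rewrite /shift_d; case: (odd _); rewrite ?linearN /= cdf_sq ?oppr0.
Qed.

Lemma shift_bounded X : exists m : nat, forall i : int, (m < `|i|)%N ->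
  forall x : X (i + n), x = 0.
Proof.
have [m Xm] := cob_bounded X; exists (m + `|n|)%N => i lt_mi; apply: Xm.
rewrite -(ltn_add2r `|n|); apply: leq_trans lt_mi _.
by rewrite -{1}[i](addrK n) -lez_nat PoszD !abszE ler_normB.
Qed.

Definition shift X : cplx R :=
  @Cplx R (fun i : int => X (i + n)) (fun i j : int => @shift_d X i j)
    (@shift_d_shape X) (@shift_d_sq X) (fun i : int => cob_fg X (i + n)) (shift_bounded X).

Lemma cshift_d X Y (f : cmap X Y) (i j : int) (x : X (i + n)) :
  f (j + n) (shift_d j x) = shift_d j (f (i + n) x).
Proof. by rewrite /shift_d; case: (odd _); rewrite ?linearN /= cmf_d. Qed.

Definition cshift X Y (f : cmap X Y) : cmap (shift X) (shift Y) :=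
  @Cmap R (shift X) (shift Y) (fun i : int => f (i + n)) (cshift_d f).

Lemma cshift_quasi_iso X Y (f : cmap X Y) : quasi_iso f -> quasi_iso (cshift f).
Proof.
have d0 (Z : cplx R) (i j : int) (z : Z (i + n)) :
  shift_d j z = 0 -> cdf Z (i + n) (j + n) z = 0.
  by rewrite /shift_d; case: (odd _) => // /eqP; rewrite oppr_eq0 => /eqP.
have dS (Z : cplx R) (i j : int) (z : Z (i + n)) :
  exists z' : Z (i + n), cdf Z (i + n) (j + n) z = shift_d j z'.
  rewrite /shift_d; case: (odd _); last by exists z.
  by exists (- z); rewrite linearN opprK.
have Sd (Z : cplx R) (i j : int) (z : Z (i + n)) :
  exists z' : Z (i + n), shift_d j z = cdf Z (i + n) (j + n) z'.
  rewrite /shift_d; case: (odd _); last by exists z.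
  by exists (- z); rewrite linearN.
have S1 (i : int) : i + n + 1 = i + 1 + n by rewrite addrAC.
have B1 (i : int) : i + n - 1 = i - 1 + n by rewrite addrAC.
move=> [fI fS]; split=> i.
  move=> x /= /d0 dx [y] fx; have:= fI (i + n) x; rewrite S1 B1 => /(_ dx).
  by case=> [|x' ->]; [rewrite fx; apply: Sd | apply: dS].
move=> y /= /d0 dy; have := fS (i + n) y; rewrite S1 B1 => /(_ dy).
move=> [x [dx [y' fxy]]]; exists x; split.
  by rewrite /shift_d dx oppr0 if_same.
by rewrite fxy; apply: dS.
Qed.

End Shift.

Section Cone.
Variables (R : pzRingType) (X Y : cplx R) (f : cmap X Y).

(* The identity [Y i -> Y j] when [i = j], and zero otherwise. *)
Definition deg_id (i j : int) (y : Y i) : Y j :=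
  if i =P j is ReflectT e then ecast k (Y k) e y else 0.

Lemma deg_idE i y : @deg_id i i y = y.
Proof. by rewrite /deg_id; case: eqP => // e; rewrite eq_axiomK. Qed.

Lemma deg_id_linear i j : linear (@deg_id i j).
Proof.
move=> a u v; rewrite /deg_id; case: eqP => [e|_]; last by rewrite scaler0 addr0.
by case: j / e.
Qed.

Lemma deg_id_neq i j y : i != j -> @deg_id i j y = 0.
Proof. by rewrite /deg_id; case: eqP. Qed.

Definition cone_d (i j : int) (z : (X (i + 1)%R * Y i)%type) :
    (X (j + 1)%R * Y j)%type :=
  (- cdf X (i + 1) (j + 1) z.1, deg_id j (f (i + 1) z.1) + cdf Y i j z.2).

Lemma cone_d_linear (i j : int) : linear (@cone_d i j).
Proof.
move=> a [x y] [x' y']; rewrite /cone_d /=; congr (_, _) => /=.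
  by rewrite linearP opprD scalerN.
by rewrite !linearP deg_id_linear scalerDr addrACA.
Qed.

HB.instance Definition _ (i j : int) :=
  GRing.isLinear.Build R (X (i + 1)%R * Y i)%type (X (j + 1)%R * Y j)%type _
    (@cone_d i j) (@cone_d_linear i j).

Lemma cone_d_shape (i j : int) : j != i + 1 -> forall z, @cone_d i j z = 0.
Proof.
move=> ij [x y]; rewrite /cone_d /= !cdf_shape ?(inj_eq (addIr 1)) //.
by rewrite deg_id_neq 1?eq_sym // oppr0 addr0.
Qed.

Lemma cone_d_sq (i j k : int) z : @cone_d j k (@cone_d i j z) = 0.
Proof.
have [->|ij] := eqVneq j (i + 1); last by rewrite (cone_d_shape ij) linear0.
have [->|jk] := eqVneq k (i + 1 + 1); last by rewrite cone_d_shape.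
case: z => x y; rewrite /cone_d /= !deg_idE linearN /= cdf_sq !oppr0.
congr (_, _); rewrite linearD /= cdf_sq addr0 -cmf_d linearN /=.
by rewrite addNr.
Qed.

Lemma cone_bounded : exists m : nat, forall i : int, (m < `|i|)%N ->
  forall z : (X (i + 1)%R * Y i)%type, z = 0.
Proof.
have [m Xm] := shift_bounded 1 X; have [n Yn] := cob_bounded Y.
exists (maxn m n) => i; rewrite gtn_max => /andP[mi ni] [x y].
by congr (_, _); [apply: Xm | apply: Yn].
Qed.

Definition cone : cplx R :=
  @Cplx R (fun i : int => (X (i + 1)%R * Y i)%type)
    (fun i j : int => @cone_d i j) cone_d_shape cone_d_sq
    (fun i : int => fin_gen_prod (cob_fg X (i + 1)) (cob_fg Y i)) cone_bounded.

Definition cone_in_f (i : int) (y : Y i) : cone i := (0, y).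

Lemma cone_in_linear (i : int) : linear (@cone_in_f i).
Proof. by move=> a u v; congr (_, _); rewrite /= scaler0 addr0. Qed.

HB.instance Definition _ (i : int) :=
  GRing.isLinear.Build R (Y i) (cone i) _ (@cone_in_f i) (@cone_in_linear i).

Lemma cone_in_d (i j : int) (y : Y i) :
  cone_in_f (cdf Y i j y) = cdf cone i j (cone_in_f y).
Proof.
rewrite /= /cone_d /cone_in_f /=; congr (_, _); first by rewrite linear0 oppr0.
rewrite linear0 /deg_id; case: eqP => [e|_]; last by rewrite add0r.
by case: j / e; rewrite add0r.
Qed.

Definition cone_in : cmap Y cone :=
  @Cmap R Y cone (fun i : int => @cone_in_f i) cone_in_d.

Definition cone_out_f (i : int) (z : cone i) : shift 1 X i := z.1.

Lemma cone_out_linear (i : int) : linear (@cone_out_f i).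
Proof. by []. Qed.

HB.instance Definition _ (i : int) :=
  GRing.isLinear.Build R (cone i) (shift 1 X i) _ (@cone_out_f i)
    (@cone_out_linear i).

Definition cone_out : cmap cone (shift 1 X) :=
  @Cmap R cone (shift 1 X) (fun i : int => @cone_out_f i) (fun _ _ _ => erefl).

End Cone.

Section DirectSum.
Variable R : pzRingType.
Implicit Types X Y Z : cplx R.

Definition dsum_d X Y (i j : int) (z : (X i * Y i)%type) : (X j * Y j)%type :=
  (cdf X i j z.1, cdf Y i j z.2).

Lemma dsum_d_linear X Y (i j : int) : linear (@dsum_d X Y i j).
Proof. by move=> a u v; rewrite /dsum_d /= !linearP. Qed.

HB.instance Definition _ X Y (i j : int) :=
  GRing.isLinear.Build R (X i * Y i)%type (X j * Y j)%type _
    (@dsum_d X Y i j) (@dsum_d_linear X Y i j).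

Lemma dsum_d_shape X Y (i j : int) : j != i + 1 ->
  forall z, @dsum_d X Y i j z = 0.
Proof. by move=> ij z; rewrite /dsum_d !cdf_shape. Qed.

Lemma dsum_d_sq X Y (i j k : int) z : @dsum_d X Y j k (@dsum_d X Y i j z) = 0.
Proof. by rewrite /dsum_d /= !cdf_sq. Qed.

Lemma dsum_bounded X Y : exists m : nat, forall i : int, (m < `|i|)%N ->
  forall z : (X i * Y i)%type, z = 0.
Proof.
have [m Xm] := cob_bounded X; have [n Yn] := cob_bounded Y.
exists (maxn m n) => i; rewrite gtn_max => /andP[mi ni] [x y].
by congr (_, _); [apply: Xm | apply: Yn].
Qed.

Definition dsum X Y : cplx R :=
  @Cplx R (fun i : int => (X i * Y i)%type) (fun i j : int => @dsum_d X Y i j)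
    (@dsum_d_shape X Y) (@dsum_d_sq X Y)
    (fun i : int => fin_gen_prod (cob_fg X i) (cob_fg Y i)) (dsum_bounded X Y).

Definition csum_f X Y X' Y' (f : cmap X X') (g : cmap Y Y') (i : int)
  (z : dsum X Y i) : dsum X' Y' i := (f i z.1, g i z.2).

Lemma csum_linear X Y X' Y' (f : cmap X X') (g : cmap Y Y') (i : int) :
  linear (@csum_f X Y X' Y' f g i).
Proof. by move=> a u v; rewrite /csum_f /= !linearP. Qed.

HB.instance Definition _ X Y X' Y' (f : cmap X X') (g : cmap Y Y') (i : int) :=
  GRing.isLinear.Build R (dsum X Y i) (dsum X' Y' i) _
    (@csum_f X Y X' Y' f g i) (@csum_linear X Y X' Y' f g i).

Lemma csum_d X Y X' Y' (f : cmap X X') (g : cmap Y Y') (i j : int) z :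
  csum_f f g (cdf (dsum X Y) i j z) = cdf (dsum X' Y') i j (csum_f f g z).
Proof. by rewrite /csum_f /= /dsum_d /= !cmf_d. Qed.

Definition csum X Y X' Y' (f : cmap X X') (g : cmap Y Y') :
    cmap (dsum X Y) (dsum X' Y') :=
  @Cmap R (dsum X Y) (dsum X' Y') (fun i : int => @csum_f X Y X' Y' f g i)
    (csum_d f g).

Definition cdiag_f X (i : int) (x : X i) : dsum X X i := (x, x).

Lemma cdiag_linear X (i : int) : linear (@cdiag_f X i).
Proof. by []. Qed.

HB.instance Definition _ X (i : int) :=
  GRing.isLinear.Build R (X i) (dsum X X i) _ (@cdiag_f X i) (@cdiag_linear X i).

Definition cdiag X : cmap X (dsum X X) :=
  @Cmap R X (dsum X X) (fun i : int => @cdiag_f X i) (fun _ _ _ => erefl).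

Definition ccodiag_f X (i : int) (z : dsum X X i) : X i := z.1 + z.2.

Lemma ccodiag_linear X (i : int) : linear (@ccodiag_f X i).
Proof. by move=> a u v; rewrite /ccodiag_f /= scalerDr addrACA. Qed.

HB.instance Definition _ X (i : int) :=
  GRing.isLinear.Build R (dsum X X i) (X i) _ (@ccodiag_f X i)
    (@ccodiag_linear X i).

Lemma ccodiag_d X (i j : int) (z : dsum X X i) :
  ccodiag_f (cdf (dsum X X) i j z) = cdf X i j (ccodiag_f z).
Proof. by rewrite /ccodiag_f linearD. Qed.

Definition ccodiag X : cmap (dsum X X) X :=
  @Cmap R (dsum X X) X (fun i : int => @ccodiag_f X i) (@ccodiag_d X).

Lemma csum_quasi_iso X Y X' Y' (f : cmap X X') (g : cmap Y Y') :
  quasi_iso f -> quasi_iso g -> quasi_iso (csum f g).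
Proof.
move=> [fI fS] [gI gS]; split=> i.
  move=> [x y] [dx dy] [[x' y'] [fx gy]].
  have [|u xu] := fI i x dx; first by exists x'.
  have [|v yv] := gI i y dy; first by exists y'.
  by exists (u, v); rewrite xu yv.
move=> [x y] [dx dy]; have [u [du [u' fu]]] := fS i x dx.
have [v [dv [v' gv]]] := gS i y dy; exists (u, v); split.
  by congr (_, _).
by exists (u', v'); congr (_, _).
Qed.

End DirectSum.

Section Stalk.
Variable R : pzRingType.

Definition stalk_ob (i : int) : lmodType R :=
  if i is Posz 0 then R^o else 'rV[R]_0.

Lemma stalk_fin_gen (i : int) : fin_gen (stalk_ob i).
Proof.
case: i => [[|n]|n]; first exact: fin_gen_regular;
  by apply: fin_gen_trivial => x; apply: thinmx0.
Qed.

Lemma stalk_bounded : exists n : nat, forall i : int, (n < `|i|)%N ->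
  forall x : stalk_ob i, x = 0.
Proof. by exists 0%N => -[[|n]|n] // _ x; apply: thinmx0. Qed.

Definition stalk : cplx R :=
  @Cplx R stalk_ob (fun i j : int => \0 : {linear stalk_ob i -> stalk_ob j})
    (fun _ _ _ _ => erefl) (fun _ _ _ _ => erefl) stalk_fin_gen stalk_bounded.

End Stalk.

(* The bounded derived category is the localization of the homotopy category of
   bounded complexes at the quasi-isomorphisms, presented by generators and
   relations (Gabriel-Zisman): a morphism is a formal composite of chain maps
   and of inverses of quasi-isomorphisms, taken up to [deq]. *)
Inductive dmor (R : pzRingType) : cplx R -> cplx R -> Type :=
| DMap X Y (f : cmap X Y) : dmor X Y
| DInv X Y (s : cmap X Y) (qs : quasi_iso s) : dmor Y X
| DComp X Y Z (v : dmor Y Z) (u : dmor X Y) : dmor X Z.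

Inductive deq (R : pzRingType) :
    forall X Y : cplx R, dmor X Y -> dmor X Y -> Prop :=
| deq_refl X Y (u : dmor X Y) : deq u u
| deq_sym X Y (u v : dmor X Y) : deq u v -> deq v u
| deq_trans X Y (u v w : dmor X Y) : deq u v -> deq v w -> deq u w
| deq_comp X Y Z (v v' : dmor Y Z) (u u' : dmor X Y) :
    deq v v' -> deq u u' -> deq (DComp v u) (DComp v' u')
| deq_assoc X Y Z T (w : dmor Z T) (v : dmor Y Z) (u : dmor X Y) :
    deq (DComp w (DComp v u)) (DComp (DComp w v) u)
| deq_id_l X Y (u : dmor X Y) : deq (DComp (DMap (cid Y)) u) u
| deq_id_r X Y (u : dmor X Y) : deq (DComp u (DMap (cid X))) u
| deq_map_comp X Y Z (g : cmap Y Z) (f : cmap X Y) :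
    deq (DMap (ccomp g f)) (DComp (DMap g) (DMap f))
| deq_homotopic X Y (f g : cmap X Y) :
    homotopic f g -> deq (DMap f) (DMap g)
| deq_inv_l X Y (s : cmap X Y) (qs : quasi_iso s) :
    deq (DComp (DInv qs) (DMap s)) (DMap (cid X))
| deq_inv_r X Y (s : cmap X Y) (qs : quasi_iso s) :
    deq (DComp (DMap s) (DInv qs)) (DMap (cid Y)).

Section DerivedOperations.
Variable R : pzRingType.
Implicit Types X Y Z : cplx R.

Lemma cid_quasi_iso X : quasi_iso (cid X).
Proof.
split=> i x dx; first by [].
by exists x; split=> //; exists 0; rewrite /= subrr linear0.
Qed.

Fixpoint dshift (n : int) X Y (u : dmor X Y) : dmor (shift n X) (shift n Y) :=
  match u with
  | DMap _ _ f => DMap (cshift n f)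
  | DInv _ _ _ qs => DInv (cshift_quasi_iso n qs)
  | DComp _ _ _ w v => DComp (dshift n w) (dshift n v)
  end.

Fixpoint dsuml Z X Y (u : dmor X Y) : dmor (dsum X Z) (dsum Y Z) :=
  match u with
  | DMap _ _ f => DMap (csum f (cid Z))
  | DInv _ _ _ qs => DInv (csum_quasi_iso qs (cid_quasi_iso Z))
  | DComp _ _ _ w v => DComp (dsuml Z w) (dsuml Z v)
  end.

Fixpoint dsumr Z X Y (u : dmor X Y) : dmor (dsum Z X) (dsum Z Y) :=
  match u with
  | DMap _ _ f => DMap (csum (cid Z) f)
  | DInv _ _ _ qs => DInv (csum_quasi_iso (cid_quasi_iso Z) qs)
  | DComp _ _ _ w v => DComp (dsumr Z w) (dsumr Z v)
  end.

(* [u + v] is the composite of [u (+) v] with the diagonal of [X] and the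
   codiagonal of [Y]. *)
Definition dadd X Y (u v : dmor X Y) : dmor X Y :=
  DComp (DMap (ccodiag Y))
    (DComp (DComp (dsumr Y v) (dsuml X u)) (DMap (cdiag X))).

Definition diso X Y (u : dmor X Y) : Prop :=
  exists v : dmor Y X,
    deq (DComp v u) (DMap (cid X)) /\ deq (DComp u v) (DMap (cid Y)).

(* The distinguished triangles are those isomorphic to the triangle
   [X' -> Y' -> cone f -> shift 1 X'] of a chain map [f : X' -> Y']. *)
Definition ddist X Y Z (a : dmor X Y) (b : dmor Y Z)
    (c : dmor Z (shift 1 X)) : Prop :=
  exists (X' Y' : cplx R) (f : cmap X' Y')
    (u : dmor X X') (v : dmor Y Y') (w : dmor Z (cone f)),
    [/\ diso u, diso v & diso w] /\
    [/\ deq (DComp v a) (DComp (DMap f) u),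
        deq (DComp w b) (DComp (DMap (cone_in f)) v)
      & deq (DComp (dshift 1 u) c) (DComp (DMap (cone_out f)) w)].

End DerivedOperations.

(* A category whose hom-sets are setoids, with the additive structure, shifts
   and distinguished triangles in terms of which the notions below are stated;
   the axioms of triangulated categories are not needed to state them. *)
Record tricat := Tricat {
  tob :> Type;
  thom : tob -> tob -> Type;
  teq : forall X Y, thom X Y -> thom X Y -> Prop;
  tid : forall X, thom X X;
  tcomp : forall X Y Z, thom Y Z -> thom X Y -> thom X Z;
  tzero : forall X Y, thom X Y;
  tadd : forall X Y, thom X Y -> thom X Y -> thom X Y;
  tshift : int -> tob -> tob;
  tshift_map : forall n X Y, thom X Y -> thom (tshift n X) (tshift n Y);
  tdist : forall X Y Z, thom X Y -> thom Y Z -> thom Z (tshift 1 X) -> Prop;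
  teq_refl : forall X Y (u : thom X Y), teq u u;
  teq_sym : forall X Y (u v : thom X Y), teq u v -> teq v u;
  teq_trans : forall X Y (u v w : thom X Y), teq u v -> teq v w -> teq u w;
  teq_comp : forall X Y Z (v v' : thom Y Z) (u u' : thom X Y),
    teq v v' -> teq u u' -> teq (tcomp v u) (tcomp v' u');
  tcompA : forall X Y Z T (w : thom Z T) (v : thom Y Z) (u : thom X Y),
    teq (tcomp w (tcomp v u)) (tcomp (tcomp w v) u);
  tcomp1l : forall X Y (u : thom X Y), teq (tcomp (tid Y) u) u;
  tcomp1r : forall X Y (u : thom X Y), teq (tcomp u (tid X)) u }.

Arguments thom {_} _ _.
Arguments tzero {_} _ _.
Arguments tid {_} _.
Arguments tshift {_} _ _.
Arguments tshift_map {_} _ {_ _} _.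

Declare Scope tricat_scope.
Local Open Scope tricat_scope.
Notation "u =~ v" := (teq u v) (at level 70, no associativity) : tricat_scope.
Notation "v \o u" := (tcomp v u) : tricat_scope.

Definition Db (R : pzRingType) : tricat :=
  @Tricat (cplx R) (@dmor R) (@deq R) (fun X => DMap (cid X)) (@DComp R)
    (fun X Y => DMap (czero X Y)) (@dadd R) (@shift R) (@dshift R) (@ddist R)
    (@deq_refl R) (@deq_sym R) (@deq_trans R) (@deq_comp R) (@deq_assoc R)
    (@deq_id_l R) (@deq_id_r R).

Section TriangulatedNotions.
Variable T : tricat.

Definition tiso (X Y : T) (u : thom X Y) : Prop :=
  exists v : thom Y X, v \o u =~ tid X /\ u \o v =~ tid Y.

Definition hom_trivial (X Y : T) : Prop := forall u : thom X Y, u =~ tzero X Y.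

Definition ev_orth (X Y : T) : Prop :=
  exists n : nat, forall i : int, (n < `|i|)%N -> hom_trivial X (tshift i Y).

Definition is_direct_sum (X Y Z : T) : Prop :=
  exists (iX : thom X Z) (iY : thom Y Z) (pX : thom Z X) (pY : thom Z Y),
    [/\ pX \o iX =~ tid X, pY \o iY =~ tid Y, pY \o iX =~ tzero X Y,
        pX \o iY =~ tzero Y X & tadd (iX \o pX) (iY \o pY) =~ tid Z].

Definition direct_summand (X Z : T) : Prop := exists Y, is_direct_sum X Y Z.

Record tri_subcat (P : T -> Prop) : Prop := TriSubcat {
  tri_subcat_nonempty : exists X, P X;
  tri_subcat_shift : forall n X, P X -> P (tshift n X);
  tri_subcat_dist : forall X Y Z (a : thom X Y) (b : thom Y Z)
    (c : thom Z (tshift 1 X)), tdist a b c ->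
    [/\ P X -> P Y -> P Z, P Y -> P Z -> P X & P X -> P Z -> P Y] }.

Definition thick (P : T -> Prop) : Prop :=
  tri_subcat P /\ forall X Z, direct_summand X Z -> P Z -> P X.

Definition Thick (G X : T) : Prop :=
  forall P : T -> Prop, thick P -> P G -> P X.

End TriangulatedNotions.

Record tfunctor (C D : tricat) := Tfunctor {
  fob :> C -> D;
  fmap : forall X Y : C, thom X Y -> thom (fob X) (fob Y);
  fmap_eq : forall (X Y : C) (u v : thom X Y), u =~ v -> fmap u =~ fmap v;
  fmap_id : forall X : C, fmap (tid X) =~ tid (fob X);
  fmap_comp : forall (X Y Z : C) (v : thom Y Z) (u : thom X Y),
    fmap (v \o u) =~ fmap v \o fmap u }.

Definition idfunctor (C : tricat) : tfunctor C C :=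
  @Tfunctor C C (fun X => X) (fun X Y u => u) (fun X Y u v uv => uv)
    (fun X => teq_refl (tid X)) (fun X Y Z v u => teq_refl (v \o u)).

Definition compfunctor (C D E : tricat) (G : tfunctor D E) (F : tfunctor C D) :
    tfunctor C E :=
  @Tfunctor C E (fun X => G (F X)) (fun X Y u => fmap G (fmap F u))
    (fun X Y u v uv => fmap_eq G (fmap_eq F uv))
    (fun X => teq_trans (fmap_eq G (fmap_id F X)) (fmap_id G (F X)))
    (fun X Y Z v u => teq_trans (fmap_eq G (fmap_comp F v u))
      (fmap_comp G (fmap F v) (fmap F u))).

Definition nat_iso (C D : tricat) (F G : tfunctor C D) : Prop :=
  exists t : forall X : C, thom (F X) (G X),
    (forall X, tiso (t X)) /\
    forall (X Y : C) (u : thom X Y), t Y \o fmap F u =~ fmap G u \o t X.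

Definition equivalence (C D : tricat) (F : tfunctor C D) : Prop :=
  exists G : tfunctor D C,
    nat_iso (compfunctor G F) (idfunctor C) /\
    nat_iso (compfunctor F G) (idfunctor D).

Definition triangulated_functor (C D : tricat) (F : tfunctor C D) : Prop :=
  (forall (X Y : C) (u v : thom X Y),
     fmap F (tadd u v) =~ tadd (fmap F u) (fmap F v)) /\
  exists t : forall X : C, thom (F (tshift 1 X)) (tshift 1 (F X)),
    [/\ forall X, tiso (t X),
        forall (X Y : C) (u : thom X Y),
          t Y \o fmap F (tshift_map 1 u) =~ tshift_map 1 (fmap F u) \o t X
      & forall (X Y Z : C) (a : thom X Y) (b : thom Y Z)
          (c : thom Z (tshift 1 X)), tdist a b c ->
          tdist (fmap F a) (fmap F b) (t X \o fmap F c)].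

Definition derived_equivalent (R S : pzRingType) : Prop :=
  exists F : tfunctor (Db R) (Db S), triangulated_functor F /\ equivalence F.

(* Main.v *)
Require Import Defs.
From HB Require Import structures.
From Corelib Require Import Setoid.
From mathcomp Require Import all_boot all_order all_algebra zify.

(* A derived equivalence F with inverse G sends R into Thick(S).  Write D^{<=m} and D^{>m} for the
   complexes with cohomology in degrees <= m and > m.  Since G(S) is a bounded
   complex, it lies in some D^{<=k}; as H^i(F X) = Hom(G(S), X[i]), F maps
   D^{>m+k} into D^{>m}, so that G maps the left orthogonal D^{<=m} of D^{>m}
   into D^{<=m+k}.  Hence Hom(F(R), Z) = H^0(G Z) = 0 for Z in D^{<=-k-1}.  Killing
   top cohomology with free modules yields a map F(R) -> Z with cone in Thick(S)
   and Z in D^{<=-k-1}; that map vanishes, so F(R) is a direct summand of an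
   object of Thick(S).

   If now N is orthogonal to N and S, it is orthogonal to F(R), as the
   objects to which N is orthogonal form a thick subcategory.  So G(N) is
   orthogonal to G(N) and R, whence G(N) lies in Thick(R) and N = F(G(N)) in
   Thick(S).

   Equality of morphisms of the localization is analysed through right
   fractions: DMap f = DMap g if and only if f t and g t are homotopic for some
   quasi-isomorphism t. *)

Set Implicit Arguments.
Unset Strict Implicit.
Unset Printing Implicit Defensive.

Import GRing.Theory Num.Theory.
Local Open Scope ring_scope.

(** * Normalization in abelian groups *)

Section AbelianGroupNormalization.
Variable V : zmodType.

Inductive zterm := ZVar of nat | ZZero | ZAdd of zterm & zterm | ZOpp of zterm.

Fixpoint zeval (e : seq V) t : V :=
  match t with
  | ZVar n => nth 0 e n
  | ZZero => 0
  | ZAdd a b => zeval e a + zeval e b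
  | ZOpp a => - zeval e a
  end.

Fixpoint zcoef t (i : nat) : int :=
  match t with
  | ZVar n => if n == i then 1 else 0
  | ZZero => 0
  | ZAdd a b => zcoef a i + zcoef b i
  | ZOpp a => - zcoef a i
  end.

Lemma zevalE e t : zeval e t = \sum_(i < size e) e`_i *~ zcoef t i.
Proof.
elim: t => [n||a IHa b IHb|a IHa] /=; rewrite ?IHa ?IHb.
- have [ln|ln] := ltnP n (size e); last first.
    (* An index outside the environment denotes 0, the default of [nth]. *)
    rewrite nth_default // big1 // => i _.
    by case: eqP => // ni; move: (ltn_ord i); rewrite -ni ltnNge ln.
  rewrite (bigD1 (Ordinal ln)) //= eqxx mulr1z big1 ?addr0 // => i.
  by rewrite -val_eqE /= eq_sym => /negbTE->.
- by rewrite big1.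
- by rewrite -big_split; apply: eq_bigr => i _; rewrite mulrzDr.
- by rewrite -sumrN; apply: eq_bigr => i _; rewrite mulrNz.
Qed.

(** Both sides depend only on the integer coefficients of the atoms, and comparing these is a closed
    boolean computation. *)
Lemma zeval_eq e t u :
  all (fun i => zcoef t i == zcoef u i) (iota 0 (size e)) ->
  zeval e t = zeval e u.
Proof.
move=> /allP tu; rewrite !zevalE; apply: eq_bigr => i _.
by rewrite (eqP (tu i _)) // mem_iota ltn_ord.
Qed.

End AbelianGroupNormalization.

(** Atoms are identified by [unify], so subterms that agree only up to conversion share an index.
    The vacuous [match goal] runs that tactic while a term is being built. *)
Ltac zindex x e :=
  match e with
  | ?y :: _ => let _ := match goal with _ => unify x y end in constr:(0%N)
  | _ :: ?e' => let n := zindex x e' in constr:(S n)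
  end.
Ltac zinsert x e :=
  match e with
  | _ => let n := zindex x e in e
  | _ => constr:(x :: e)
  end.
Ltac zatoms x e :=
  lazymatch x with
  | (?a + ?b)%R => let e' := zatoms a e in zatoms b e'
  | (- ?a)%R => zatoms a e
  | 0%R => e
  | _ => zinsert x e
  end.
Ltac zquote x e :=
  lazymatch x with
  | (?a + ?b)%R => let s := zquote a e in let t := zquote b e in constr:(ZAdd s t)
  | (- ?a)%R => let s := zquote a e in constr:(ZOpp s)
  | 0%R => constr:(ZZero)
  | _ => let n := zindex x e in constr:(ZVar n)
  end.
Ltac zmod :=
  lazymatch goal with
  | |- @eq ?T ?a ?b =>
    let e0 := constr:(@nil T) in
    let e1 := zatoms a e0 in
    let e := zatoms b e1 in
    let s := zquote a e in
    let t := zquote b e in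
    refine (@zeval_eq _ e s t isT)
  end.

(** * Submodules over noetherian rings *)

Definition lin (R : pzRingType) (U V : lmodType R) (f : U -> V)
    (lf : linear f) : {linear U -> V} :=
  HB.pack f (GRing.isLinear.Build R U V _ f lf).

(** This gives finite generation of truncated complexes, and finitely many cycles representing each
    cohomology module. *)
Lemma noetherian_span (R : pzRingType) (M : lmodType R) (n : nat) (g : 'I_n -> M)
    (A : M -> Prop) :
  left_noetherian R ->
  A 0 -> (forall a x y, A x -> A y -> A (a *: x + y)) ->
  (forall x, A x -> exists c, x = \sum_i c i *: g i) ->
  exists (m : nat) (h : 'I_m -> M), (forall i, A (h i)) /\
    forall x, A x -> exists c, x = \sum_i c i *: h i.
Proof.
move=> noethR; elim: n g A => [|n IHn] g A A0 AP Ag.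
  exists 0%N, (fun=> 0); split=> [[]//|x /Ag[c ->]].
  by exists (fun=> 0); rewrite !big_ord0.
have AD x y : A x -> A y -> A (x + y).
  by move=> Ax Ay; rewrite -[x]scale1r; apply: AP.
have AZ a x : A x -> A (a *: x) by move=> Ax; rewrite -[_ *: _]addr0; apply: AP.
(* Leading coefficients form a left ideal; what remains lies in the span of n generators. *)
pose I r := exists c : 'I_n -> R, A (r *: g ord0 + \sum_i c i *: g (lift ord0 i)).
have [|m [r [rI Ir]]] := noethR I.
  split=> [|r s [c Ac] [d Ad]|a r [c Ac]].
  - by exists (fun=> 0); rewrite scale0r add0r big1 // => i _; rewrite scale0r.
  - exists (fun i => c i + d i).
    under eq_bigr do rewrite scalerDl.
    by rewrite big_split scalerDl addrACA; apply: AD.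
  - exists (fun i => a * c i); under eq_bigr do rewrite -scalerA.
    by rewrite -scaler_sumr -scalerA -scalerDr; apply: AZ.
have /fin_all_exists [a aP] : forall j, exists x, A x /\
    exists c : 'I_n -> R, x = r j *: g ord0 + \sum_i c i *: g (lift ord0 i).
  by move=> j; have [c Ac] := rI j; eexists; split; [exact: Ac | exists c].
pose A' x := A x /\ exists c : 'I_n -> R, x = \sum_i c i *: g (lift ord0 i).
have [|b x y [Ax [c cx]] [Ay [d dy]]|x []//|p [h [hA' A'h]]] :=
    IHn (fun i => g (lift ord0 i)) A'.
- by split=> //; exists (fun=> 0); rewrite big1 // => i _; rewrite scale0r.
- split; first exact: AP.
  exists (fun i => b * c i + d i); rewrite cx dy scaler_sumr -big_split.
  by apply: eq_bigr => i _; rewrite scalerDl scalerA.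
exists (m + p)%N, (fun i => match split i with inl j => a j | inr k => h k end).
split=> [i|x Ax]; first by case: (split i) => j; [case: (aP j) | case: (hA' j)].
have [c cx] := Ag x Ax; have [|e er] := Ir (c ord0).
  by exists (fun i => c (lift ord0 i)); rewrite -(big_ord_recl n (fun i => c i *: g i)) -cx.
have Aa : A (\sum_j e j *: a j).
  elim/big_ind: _ => [//||j _]; [exact: AD | by apply: AZ; case: (aP j)].
(* Subtracting the lifts [a j] cancels the coefficient of [g ord0], so the difference lies in
   [A']. *)
have [|f fx] := A'h (x - \sum_j e j *: a j).
  split; first by rewrite addrC -scaleN1r; apply: AP.
  have /fin_all_exists [d dP] : forall j, exists d : 'I_n -> R,
      a j = r j *: g ord0 + \sum_i d i *: g (lift ord0 i).
    by move=> j; case: (aP j) => _ [d ->]; exists d.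
  exists (fun i => c (lift ord0 i) - \sum_j e j * d j i).
  rewrite cx big_ord_recl er.
  under [X in _ - X]eq_bigr do rewrite dP scalerDr scalerA.
  rewrite big_split /= -scaler_suml [_ *: _ + _]addrC addrKA.
  under [RHS]eq_bigr do rewrite scalerBl scaler_suml.
  rewrite sumrB; congr (_ - _); rewrite exchange_big /=.
  by apply: eq_bigr => j _; rewrite scaler_sumr; apply: eq_bigr => i _; rewrite scalerA.
exists (fun i => match split i with inl j => e j | inr k => f k end).
rewrite big_split_ord /= -[LHS](subrK (\sum_j e j *: a j)) fx addrC.
congr (_ + _); apply: eq_bigr => i _.
  by rewrite -[rshift m i]/(unsplit (inr i)) unsplitK.
by rewrite -[lshift p i]/(unsplit (inl i)) unsplitK.
Qed.

(** * Cycles, boundaries and homotopies *)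

Section Complexes.
Variable R : pzRingType.
Implicit Types X Y Z W : cplx R.

(** The adjacent degree is left free here and in [bnd], which avoids transport between degrees that
    are equal but not convertible; [cycP] and [bndP] return to a chosen adjacent degree. *)
Definition cyc X i (x : X i) := forall j, cdf X i j x = 0.
Definition bnd X i (x : X i) := exists j (y : X j), x = cdf X j i y.
Definition acyc_at X i := forall x : X i, cyc x -> bnd x.
Definition acyc X := forall i, acyc_at X i.

Lemma cycP X i j (x : X i) : i + 1 = j -> cdf X i j x = 0 -> cyc x.
Proof.
move=> <- dx k; have [->//|ik] := eqVneq k (i + 1).
exact: cdf_shape.
Qed.

Lemma bndP X i j (x : X i) : j + 1 = i -> bnd x ->
  exists y : X j, x = cdf X j i y.
Proof.
move=> ji [k [y ->]]; have [e|kj] := eqVneq k j; first by subst k; exists y.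
exists 0; rewrite linear0 cdf_shape //; lia.
Qed.

Lemma bnd_d X i j (x : X i) : bnd (cdf X i j x). Proof. by exists i, x. Qed.
Lemma cyc0 X i : cyc (0 : X i). Proof. by move=> j; rewrite linear0. Qed.
Lemma bnd0 X i : bnd (0 : X i). Proof. by exists i, 0; rewrite linear0. Qed.
Lemma bnd_cyc X i (x : X i) : bnd x -> cyc x.
Proof. by move=> [j [y ->]] k; rewrite cdf_sq. Qed.
Lemma bndD X i (x y : X i) : bnd x -> bnd y -> bnd (x + y).
Proof.
have e : i - 1 + 1 = i by lia.
move=> /(bndP e)[a ->] /(bndP e)[b ->]; rewrite -linearD; exact: bnd_d.
Qed.
Lemma bndZ X i c (x : X i) : bnd x -> bnd (c *: x).
Proof. by move=> [j [y ->]]; rewrite -linearZ; exact: bnd_d. Qed.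
Lemma bndN X i (x : X i) : bnd x -> bnd (- x).
Proof. by move=> [j [y ->]]; rewrite -linearN; exact: bnd_d. Qed.
Lemma bndB X i (x y : X i) : bnd x -> bnd y -> bnd (x - y).
Proof. by move=> bx ny; apply/bndD/bndN. Qed.
Lemma bndC X i (x y : X i) : bnd (x - y) -> bnd (y - x).
Proof. by move=> /bndN; rewrite opprB. Qed.
Lemma bnd_trans X i (y x z : X i) : bnd (x - y) -> bnd (y - z) -> bnd (x - z).
Proof. by move=> xy /(bndD xy); rewrite addrA subrK. Qed.
Lemma cyc_map X Y (f : cmap X Y) i (x : X i) : cyc x -> cyc (f i x).
Proof. by move=> cx j; rewrite -cmf_d cx linear0. Qed.
Lemma bnd_map X Y (f : cmap X Y) i (x : X i) : bnd x -> bnd (f i x).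
Proof. by move=> [j [y ->]]; rewrite cmf_d; exact: bnd_d. Qed.
Lemma bnd_eq X i (x : X i) : x = 0 -> bnd x.
Proof. by move->; apply: bnd0. Qed.

Lemma qisP X Y (f : cmap X Y) :
  (forall i (x : X i), cyc x -> bnd (f i x) -> bnd x) ->
  (forall i (y : Y i), cyc y -> exists x, cyc x /\ bnd (f i x - y)) ->
  quasi_iso f.
Proof.
move=> fI fS; split=> i.
  move=> x dx [y fx]; apply: bndP; first by lia.
  by apply: fI; [apply: (cycP erefl dx) | rewrite fx; apply: bnd_d].
move=> y dy; have [|x [cx bx]] := fS i y; first exact: (cycP erefl dy).
by exists x; split; [exact: cx | by apply: bndP bx; lia].
Qed.

Lemma qisI X Y (f : cmap X Y) i (x : X i) :
  quasi_iso f -> cyc x -> bnd (f i x) -> bnd x.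
Proof.
move=> [fI _] cx bx; have [|y ->] := fI i x (cx _); last exact: bnd_d.
by apply: bndP bx; lia.
Qed.

Lemma qisS X Y (f : cmap X Y) i (y : Y i) :
  quasi_iso f -> cyc y -> exists x, cyc x /\ bnd (f i x - y).
Proof.
move=> [_ fS] cy; have [x [cx [z e]]] := fS i y (cy _).
exists x; split; first exact: (cycP erefl cx).
by rewrite e; apply: bnd_d.
Qed.

Lemma qis_comp X Y Z (g : cmap Y Z) (f : cmap X Y) :
  quasi_iso g -> quasi_iso f -> quasi_iso (ccomp g f).
Proof.
move=> qg qf; apply: qisP => i x cx.
  by move=> /(qisI qg (cyc_map f cx)) /(qisI qf cx).
have [y [cy yx]] := qisS qg cx; have [w [cw wy]] := qisS qf cy.
exists w; split=> //; apply: bnd_trans yx.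
by have := bnd_map g wy; rewrite linearB.
Qed.

Lemma qis_acyc_at X Y (f : cmap X Y) i : quasi_iso f ->
  acyc_at X i <-> acyc_at Y i.
Proof.
move=> qf; split=> A x cx; last by apply: (qisI qf cx); apply/A/cyc_map.
have [y [cy yx]] := qisS qf cx.
by rewrite -[x]opprK -[- x](addKr (f i y)) opprD opprK; apply/bndB/yx/bnd_map/A.
Qed.

Lemma acyc_qis X Y (f : cmap X Y) : acyc X -> acyc Y -> quasi_iso f.
Proof.
move=> aX aY; apply: qisP => i x cx; first by move=> _; apply: aX.
exists 0; split; first exact: cyc0.
by rewrite linear0 sub0r; apply/bndN/aY.
Qed.

(** Unless [j = i + 1] both differentials vanish, so commutation is only to be checked there. *)
Lemma cmap_of_subproof X Y (f : forall i, {linear X i -> Y i}) :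
  (forall i j x, i + 1 = j -> f j (cdf X i j x) = cdf Y i j (f i x)) ->
  forall i j x, f j (cdf X i j x) = cdf Y i j (f i x).
Proof.
move=> H i j x; have [/esym|ij] := eqVneq j (i + 1); first exact: H.
by rewrite !cdf_shape // linear0.
Qed.

Definition cmap_of X Y (f : forall i, {linear X i -> Y i})
  (H : forall i j x, i + 1 = j -> f j (cdf X i j x) = cdf Y i j (f i x)) :
  cmap X Y := Cmap (cmap_of_subproof H).

Lemma deg_idD X i j (x y : X i) : deg_id j (x + y) = deg_id j x + deg_id j y.
Proof. by have := deg_id_linear j 1 x y; rewrite !scale1r. Qed.
Lemma deg_id0 X i j : deg_id j (0 : X i) = 0.
Proof. by apply: (addrI (deg_id j (0 : X i))); rewrite -deg_idD !addr0. Qed.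
Lemma deg_idZ X i j c (x : X i) : deg_id j (c *: x) = c *: deg_id j x.
Proof. by have := deg_id_linear j c x 0; rewrite !addr0 deg_id0 addr0. Qed.
Lemma deg_idN X i j (x : X i) : deg_id j (- x) = - deg_id j x.
Proof. by rewrite -scaleN1r deg_idZ scaleN1r. Qed.

(** Here [deg_id] acts as transport along an equality of degrees. This lemma and the next ones move
    it past differentials and chain maps, leaving equations of degrees to [lia]. *)
Lemma deg_id_d j X i i' j' (x : X i) : i = i' -> j = j' ->
  cdf X i' j' (deg_id i' x) = deg_id j' (cdf X i j x).
Proof. by move=> e e'; subst; rewrite !deg_idE. Qed.
Lemma deg_id_dr X i j j' (x : X i) : j = j' ->
  deg_id j' (cdf X i j x) = cdf X i j' x.
Proof. by move=> e; subst; rewrite deg_idE. Qed.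
Lemma deg_id_map X Y (f : cmap X Y) i j (x : X i) :
  f j (deg_id j x) = deg_id j (f i x).
Proof.
have [e|ij] := eqVneq i j; first by subst; rewrite !deg_idE.
by rewrite !deg_id_neq // linear0.
Qed.
Lemma deg_id_id X i j k (x : X i) : i = j ->
  deg_id k (deg_id j x) = deg_id k x.
Proof. by move=> e; subst; rewrite deg_idE. Qed.
Lemma deg_idK X i j (x : X i) : i = j -> deg_id i (deg_id j x) = x.
Proof. by move=> e; subst; rewrite !deg_idE. Qed.
Lemma cyc_deg X i j (x : X i) : i = j -> cyc (deg_id j x) <-> cyc x.
Proof. by move=> e; subst; rewrite deg_idE. Qed.
Lemma bnd_deg X i j (x : X i) : i = j -> bnd (deg_id j x) <-> bnd x.
Proof. by move=> e; subst; rewrite deg_idE. Qed.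

(** The degrees [i - 1] and [i + 1] of the definition become variables, so that they can be matched
    with expressions that are merely provably equal to them. *)
Lemma homotopic_at X Y (f g : cmap X Y) : homotopic f g ->
  exists h : forall i j, {linear X i -> Y j}, forall k i l x,
    k + 1 = i -> i + 1 = l ->
    f i x - g i x = cdf Y k i (h i k x) + h l i (cdf X i l x).
Proof.
move=> [h hP]; exists h => k i l x ki <-.
by have -> : k = i - 1 by lia.
Qed.

Lemma eq_homotopic X Y (f g : cmap X Y) :
  (forall i x, f i x = g i x) -> homotopic f g.
Proof.
by move=> fg; exists (fun _ _ => \0) => i x; rewrite fg subrr /= linear0 addr0.
Qed.
Lemma homotopic_refl X Y (f : cmap X Y) : homotopic f f.
Proof. exact: eq_homotopic. Qed.
Lemma homotopic_sym X Y (f g : cmap X Y) : homotopic f g -> homotopic g f.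
Proof.
move=> [h hP]; exists (fun i j => lin (linearP (\- (h i j)))) => i x.
by rewrite /= linearN -opprD -hP opprB.
Qed.
Lemma homotopic_trans X Y (f g k : cmap X Y) :
  homotopic f g -> homotopic g k -> homotopic f k.
Proof.
move=> [h hP] [h' hP']; exists (fun i j => h i j \+ h' i j) => i x.
by rewrite /= linearD addrACA -hP -hP' addrA subrK.
Qed.
Lemma homotopic_comp X Y Z (g g' : cmap Y Z) (f f' : cmap X Y) :
  homotopic g g' -> homotopic f f' -> homotopic (ccomp g f) (ccomp g' f').
Proof.
move=> [h hP] [k kP]; apply: (@homotopic_trans _ _ _ (ccomp g' f)).
  exists (fun i j => h i j \o f i) => i x.
  by rewrite /= hP cmf_d.
exists (fun i j => g' j \o k i j) => i x.
by rewrite /= -linearB kP linearD /= cmf_d.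
Qed.
Lemma homotopic_bnd X Y (f g : cmap X Y) i (x : X i) :
  homotopic f g -> cyc x -> bnd (f i x - g i x).
Proof. by move=> [h hP] cx; rewrite hP cx linear0 addr0; apply: bnd_d. Qed.

End Complexes.
Arguments cyc {R X i}.
Arguments bnd {R X i}.

(** * Homotopy fibres and the Ore conditions *)

Section Shifts.
Variable R : pzRingType.
Implicit Types X Y Z W : cplx R.

Lemma cyc_shift X n (i : int) (x : X (i + n)) :
  cyc (x : shift n X i) <-> cyc x.
Proof.
split=> cx.
  apply: (@cycP _ _ _ (i + 1 + n)); first by lia.
  by have:= cx (i + 1); rewrite /= /shift_d; case: odd => // /eqP; rewrite oppr_eq0 => /eqP.
by move=> j; rewrite /= /shift_d cx oppr0 if_same.
Qed.

Lemma bnd_shift X n (i : int) (x : X (i + n)) :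
  bnd (x : shift n X i) <-> bnd x.
Proof.
split=> [[j [y ->]]|].
  by rewrite /= /shift_d; case: odd; [apply/bndN/bnd_d | apply: bnd_d].
case/(@bndP _ _ _ (i - 1 + n)) => [|y ->]; first by lia.
case: (boolP (odd `|n|)) => on; [exists (i - 1), (- y : X _) | exists (i - 1), y].
  by rewrite /= /shift_d on linearN opprK.
by rewrite /= /shift_d (negbTE on).
Qed.

Lemma acyc_at_shift X n i : acyc_at (shift n X) i <-> acyc_at X (i + n).
Proof.
split=> A x cx; first by apply/bnd_shift/A/cyc_shift.
by apply/bnd_shift/A/cyc_shift.
Qed.

Lemma acyc_shift X n : acyc X -> acyc (shift n X).
Proof. by move=> A i; apply/acyc_at_shift. Qed.

Lemma deg_id_cone X Y (f : cmap X Y) i j (x : X (i + 1)) (y : Y i) :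
  deg_id j ((x, y) : cone f i) = (deg_id (j + 1) x, deg_id j y).
Proof.
have [e|ij] := eqVneq i j; first by subst; rewrite !deg_idE.
by rewrite !deg_id_neq ?(inj_eq (addIr 1)).
Qed.

Lemma deg_id_cone_in X Y (f : cmap X Y) i j (y : Y i) :
  deg_id j ((0, y) : cone f i) = (0, deg_id j y).
Proof. by rewrite deg_id_cone deg_id0. Qed.

(** A piece of the long exact sequence: injectivity on H^(i+1) and surjectivity on H^i kill H^i of
    the cone. Keeping the degree fixed lets it apply to truncations, which are not
    quasi-isomorphisms. *)
Lemma acyc_at_cone X Y (f : cmap X Y) i :
  (forall x : X (i + 1), cyc x -> bnd (f _ x) -> bnd x) ->
  (forall y : Y i, cyc y -> exists x, cyc x /\ bnd (f i x - y)) ->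
  acyc_at (cone f) i.
Proof.
move=> fI fS [x y] cxy; have [/= dx fx] : (cdf (cone f) i (i + 1) (x, y) = (0, 0)).
  exact: cxy.
have cx : cyc x by apply: cycP (erefl _) _; apply/eqP; rewrite -oppr_eq0 dx.
have fy : f (i + 1) x = - cdf Y i (i + 1) y.
  by apply/eqP; rewrite -addr_eq0 -fx deg_idE.
have bx : bnd x by apply: (fI _ cx); rewrite fy; apply/bndN/bnd_d.
have [|a xa] := @bndP _ _ _ (i - 1 + 1) x _ bx; first by lia.
(* With [x = d a], the element [y + f a] is a cycle; if it equals [f z + d b], then [(z - a, b)] is
   a primitive of [(x, y)]. *)
have [|z [cz bz]] := fS (y + deg_id i (f _ a)).
  apply: cycP (erefl _) _; rewrite linearD /= (deg_id_d (j := i + 1)) //; last by lia.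
  by rewrite -cmf_d deg_idE -xa fy addrN.
have [|b yb] := bndP (j := i - 1) _ (bndC bz); first by lia.
exists (i - 1), (deg_id _ z - a, b); congr (_, _) => /=.
  by rewrite linearB /= (deg_id_d (j := i + 1)) ?cz ?deg_id0 ?sub0r ?opprK //; lia.
rewrite linearB /= deg_idD deg_idN deg_id_map deg_idK; last by lia.
by rewrite -yb; zmod.
Qed.

Lemma acyc_cone X Y (f : cmap X Y) : quasi_iso f -> acyc (cone f).
Proof.
by move=> qf i; apply: acyc_at_cone => [x|y]; [apply: qisI | apply: qisS].
Qed.

End Shifts.

Section HomotopyFibre.
Variables (R : pzRingType) (X Y : cplx R) (f : cmap X Y).

(** In degree [i] this is [X (i - 1 + 1) * Y (i - 1)]; since [i - 1 + 1] and [i] are not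
    convertible, the maps to and from it involve [deg_id]. *)
Definition hfib : cplx R := shift (-1) (cone f).

Lemma hout_linear i : linear (fun z : hfib i => deg_id i z.1 : X i).
Proof. by move=> a u v; rewrite /= deg_idD deg_idZ. Qed.

Lemma hout_d (i j : int) z : i + 1 = j ->
  lin (@hout_linear j) (cdf hfib i j z) = cdf X i j (lin (@hout_linear i) z).
Proof. by move=> ij /=; rewrite opprK (deg_id_d (j := j - 1 + 1)) //; lia. Qed.

Definition hout : cmap hfib X := cmap_of hout_d.

(** The null-homotopy is the projection to [Y], up to sign. *)
Lemma hout_null : homotopic (ccomp f hout) (czero hfib Y).
Proof.
have Lh i j : linear (fun z : hfib i => - deg_id j z.2 : Y j).
  by move=> a u v; rewrite /= deg_idD deg_idZ opprD scalerN.
exists (fun i j => lin (Lh i j)) => i [x y] /=; rewrite subr0 /= !deg_idE.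
rewrite deg_idN opprK deg_idD deg_id_map deg_id_id ?deg_id_dr; [|lia|lia].
by rewrite linearN; zmod.
Qed.

(** Weak universal property of the fibre: the homotopy supplies, up to sign, the [Y] component of
    the lift. Working with a pair [g], [g'] avoids forming the difference of chain maps. *)
Lemma hlift_exists Z (g g' : cmap Z X) :
  homotopic (ccomp f g) (ccomp f g') ->
  exists l : cmap Z hfib, forall i z, hout i (l i z) = g i z - g' i z.
Proof.
move=> /homotopic_at[h hP].
have Ll i : linear (fun z => (deg_id _ (g i z - g' i z), - h i (i - 1) z) : hfib i).
  move=> a u v; congr (_, _) => /=; rewrite !linearP /= ?opprD ?scalerN //.
  by rewrite -deg_idZ -deg_idD scalerBr; congr deg_id; zmod.
have Lc i j z : i + 1 = j ->
    lin (Ll j) (cdf Z i j z) = cdf hfib i j (lin (Ll i) z).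
  move=> ij /=; congr (_, _) => /=.
    by rewrite opprK (deg_id_d (j := j)) ?linearB /= ?cmf_d //; lia.
  have := hP (i - 1) i j z; rewrite /= => hz.
  rewrite deg_id_map linearB /= deg_id_id; last by lia.
  rewrite linearN hz; [|lia|lia].
  have -> : j - 1 = i by lia.
  by rewrite deg_idE addrAC subrr add0r.
exists (cmap_of Lc) => i z /=; rewrite deg_idK //; lia.
Qed.

Lemma hfibE (i j : int) (z : hfib i) : i + 1 = j -> cdf hfib i j z =
  (cdf X (i - 1 + 1) (j - 1 + 1) z.1,
    - (deg_id (j - 1) (f (i - 1 + 1) z.1) + cdf Y (i - 1) (j - 1) z.2)).
Proof. by move=> ij; rewrite -[LHS]/(- _, - _) opprK. Qed.

(** An acyclic [Y] contributes no cohomology to the fibre. All denominators in the Ore conditions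
    arise this way. *)
Lemma hout_qis : acyc Y -> quasi_iso hout.
Proof.
move=> aY; apply: qisP => i.
  move=> [x y] cxy; have := cxy (i + 1); rewrite hfibE //= => -[/= dx fx].
  rewrite bnd_deg; last by lia.
  case/(bndP (j := i - 1 - 1 + 1)) => [|a xa]; first by lia.
  have [|k] := aY (i - 1) (y + deg_id (i - 1) (f _ a)).
    apply: (cycP (j := i + 1 - 1)); first by lia.
    rewrite linearD /= (deg_id_d (j := i - 1 + 1)) //; [|lia|lia].
    by rewrite -cmf_d -xa [LHS]addrC -[LHS]opprK fx oppr0.
  case/(ex_intro _ k)/(bndP (j := i - 1 - 1)) => [|b yb]; first by lia.
  exists (i - 1), (a, - b); rewrite hfibE; last by lia.
  congr (_, _) => //=; rewrite linearN /= -yb; zmod.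
move=> x cx; have [|k] := aY i (f i x); first exact: cyc_map.
case/(ex_intro _ k)/(bndP (j := i - 1)) => [|y xy]; first by lia.
exists (deg_id _ x, - y); split.
  apply: (cycP erefl); rewrite hfibE //=.
  rewrite (deg_id_d (j := i + 1)) ?cx ?deg_id0; [|lia|lia].
  rewrite deg_id_map deg_id_id; last by lia.
  by rewrite xy linearN /= deg_id_dr ?subrr ?oppr0 //; lia.
by apply: bnd_eq; rewrite /= deg_idK ?subrr //; lia.
Qed.

End HomotopyFibre.

Section Ore.
Variable R : pzRingType.
Implicit Types X Y Z W : cplx R.

(** Take for [W] the fibre of [Z -> Y -> cone s]. As [cone s] is acyclic, [W -> Z] is a
    quasi-isomorphism; the [X] component of [W] gives [k] up to sign, and the [Y] component gives
    the homotopy. *)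
Lemma ore_square X Y Z (s : cmap X Y) (g : cmap Z Y) : quasi_iso s ->
  exists W (t : cmap W Z) (k : cmap W X),
    quasi_iso t /\ homotopic (ccomp s k) (ccomp g t).
Proof.
move=> qs; pose W := hfib (ccomp (cone_in s) g).
have Lk i : linear (fun w : W i => - deg_id i w.2.1 : X i).
  by move=> a u v; rewrite /= deg_idD deg_idZ opprD scalerN.
have Lc i j w : i + 1 = j -> lin (Lk j) (cdf W i j w) = cdf X i j (lin (Lk i) w).
  move=> ij; rewrite hfibE //= deg_id_cone_in /= add0r opprK.
  by rewrite linearN /= (deg_id_d (j := j - 1 + 1)) //; lia.
exists W, (hout _), (cmap_of Lc); split; first exact/hout_qis/acyc_cone.
have Lh i j : linear (fun w : W i => deg_id j w.2.2 : Y j).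
  by move=> a u v; rewrite /= deg_idD deg_idZ.
exists (fun i j => lin (Lh i j)) => i [z [x y]].
rewrite /= !deg_idE deg_id_cone_in /= linearN /= !deg_id_map.
rewrite deg_idN !deg_idD !deg_id_id ?deg_id_dr; [|lia|lia|lia].
zmod.
Qed.

(** The difference [g - g'] lifts to a map [l] into the acyclic fibre of [s]; precomposing with the
    fibre [t] of [l] makes [l], hence the difference, null-homotopic. *)
Lemma ore_cancel X Y Z (s : cmap X Y) (g g' : cmap Z X) : quasi_iso s ->
  homotopic (ccomp s g) (ccomp s g') ->
  exists W (t : cmap W Z), quasi_iso t /\ homotopic (ccomp g t) (ccomp g' t).
Proof.
move=> qs /hlift_exists[l lP].
exists (hfib l), (hout l); split; first exact/hout_qis/acyc_shift/acyc_cone.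
have [h hP] := homotopic_comp (homotopic_refl (hout s)) (hout_null l).
exists h => i w; rewrite -hP -[g i _ - _]lP /= deg_id0 subr0 //.
Qed.

End Ore.

(** * Right fractions *)

Add Parametric Relation (R : pzRingType) (X Y : cplx R) : (dmor X Y) (@deq R X Y)
  reflexivity proved by (@deq_refl R X Y)
  symmetry proved by (@deq_sym R X Y)
  transitivity proved by (@deq_trans R X Y) as deq_rel.
Add Parametric Morphism (R : pzRingType) (X Y Z : cplx R) : (@DComp R X Y Z)
  with signature (@deq R Y Z) ==> (@deq R X Y) ==> (@deq R X Z) as DComp_mor.
Proof. by move=> *; apply: deq_comp. Qed.

Section Fractions.
Variable R : pzRingType.
Implicit Types X Y Z W : cplx R.

(* [Act u g h]: the morphism [u] carries [g] to [h], up to homotopy and to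
   refinement of the source [Z] at each composition. *)
Fixpoint Act X Y (u : dmor X Y) : forall Z, cmap Z X -> cmap Z Y -> Prop :=
  match u in dmor X Y return forall Z, cmap Z X -> cmap Z Y -> Prop with
  | DMap _ _ f => fun Z g h => homotopic h (ccomp f g)
  | DInv _ _ s _ => fun Z g h => homotopic (ccomp s h) g
  | DComp _ Y _ v u => fun Z g h => exists W (t : cmap W Z) (k : cmap W Y),
      [/\ quasi_iso t, Act u (ccomp g t) k & Act v k (ccomp h t)]
  end.

Lemma ccompA X Y Z W (f : cmap Z W) (g : cmap Y Z) (h : cmap X Y) :
  homotopic (ccomp f (ccomp g h)) (ccomp (ccomp f g) h).
Proof. exact: eq_homotopic. Qed.

Let hA := ccompA.
Let hS := homotopic_sym.
Let hR := homotopic_refl.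
Let hT := homotopic_trans.
Let hC := homotopic_comp.
Definition ccompA_sym X Y Z W f g h := homotopic_sym (@ccompA X Y Z W f g h).

Lemma Act_hom X Y (u : dmor X Y) Z (g g' : cmap Z X) (h h' : cmap Z Y) :
  homotopic g g' -> homotopic h h' -> Act u g h -> Act u g' h'.
Proof.
elim: {X Y} u Z g g' h h' => [X Y f|X Y s qs|X Y T v IHv u IHu] Z g g' h h' /= gg hh.
- by move=> H; apply: (hT (hS hh)); apply: (hT H); apply: hC.
- by move=> H; apply: (hT _ (hT H gg)); apply/hC/hS/hh/hR.
- move=> [W [t [k [qt a b]]]]; exists W, t, k; split=> //.
    by apply: IHu a; [apply/hC/hR/gg | apply: hR].
  by apply: IHv b; [apply: hR | apply/hC/hR/hh].
Qed.

(** For a composite, the refinement of the source is pulled back along [t] by an Ore square. *)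
Lemma Act_pre X Y (u : dmor X Y) Z (g : cmap Z X) (h : cmap Z Y) W (t : cmap W Z) :
  Act u g h -> Act u (ccomp g t) (ccomp h t).
Proof.
elim: {X Y} u Z g h W t => [X Y f|X Y s qs|X Y T v IHv u IHu] Z g h W t /=.
- by move=> H; apply: (hT _ (ccompA_sym _ _ _)); apply/hC/hR.
- by move=> H; apply: (hT (hA _ _ _)); apply/hC/hR.
- move=> [V [s [k [qs a b]]]].
  have [V' [t' [s' [qt' ts]]]] := ore_square t qs.
  exists V', t', (ccomp k s'); split=> //.
    apply: Act_hom (IHu _ _ _ _ s' a); last exact: hR.
    by apply: (hT (ccompA_sym _ _ _)); apply: (hT _ (hA _ _ _)); apply: hC.
  apply: Act_hom (IHv _ _ _ _ s' b); first exact: hR.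
  by apply: (hT (ccompA_sym _ _ _)); apply: (hT _ (hA _ _ _)); apply: hC.
Qed.

Lemma DMap_hom X Y (f g : cmap X Y) : homotopic f g -> deq (DMap f) (DMap g).
Proof. exact: deq_homotopic. Qed.

Lemma DMap_eq X Y (f g : cmap X Y) : (forall i x, f i x = g i x) ->
  deq (DMap f) (DMap g).
Proof. by move=> /eq_homotopic/deq_homotopic. Qed.

Lemma deq_cancel_r X Y Z (t : cmap X Y) (u v : dmor Y Z) : quasi_iso t ->
  deq (DComp u (DMap t)) (DComp v (DMap t)) -> deq u v.
Proof.
move=> qt uv; rewrite -(deq_id_r u) -(deq_id_r v) -(deq_inv_r qt) !deq_assoc uv.
exact: deq_refl.
Qed.

Lemma Act_sound X Y (u : dmor X Y) Z (g : cmap Z X) (h : cmap Z Y) :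
  Act u g h -> deq (DComp u (DMap g)) (DMap h).
Proof.
elim: {X Y} u Z g h => [X Y f|X Y s qs|X Y T v IHv u IHu] Z g h /=.
- by move=> H; rewrite -deq_map_comp; apply/deq_sym/DMap_hom.
- move=> /DMap_hom <-; rewrite deq_map_comp deq_assoc deq_inv_l deq_id_l.
  exact: deq_refl.
- move=> [W [t [k [qt /IHu a /IHv b]]]].
  apply: (deq_cancel_r qt).
  by rewrite -!deq_assoc -deq_map_comp a b deq_map_comp; apply: deq_refl.
Qed.

(** Only a formal inverse obstructs pushing [g] forward, and there an Ore square provides the
    refinement. *)
Lemma Act_total X Y (u : dmor X Y) Z (g : cmap Z X) :
  exists W (t : cmap W Z) (h : cmap W Y), quasi_iso t /\ Act u (ccomp g t) h.
Proof.
elim: {X Y} u Z g => [X Y f|X Y s qs|X Y T v IHv u IHu] Z g /=.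
- exists Z, (cid Z), (ccomp f (ccomp g (cid Z))); split; last exact: hR.
  exact: cid_quasi_iso.
- by have [W [t [k [qt H]]]] := ore_square g qs; exists W, t, k.
- have [W [t [h [qt a]]]] := IHu Z g; have [V [s [k [qs b]]]] := IHv W h.
  exists V, (ccomp t s), k; split; first exact: qis_comp.
  exists V, (cid V), (ccomp h s); split; first exact: cid_quasi_iso.
    by apply: Act_hom (Act_pre s a); [apply: eq_homotopic | apply: hR].
  by apply: Act_hom b; [apply: hR | apply: eq_homotopic].
Qed.

(** Pushing the identity of [X] forward along [u] gives [u t = h] for a quasi-isomorphism [t]. *)
Lemma fraction X Y (u : dmor X Y) : exists W (s : cmap W X) (qs : quasi_iso s)
  (f : cmap W Y), deq u (DComp (DMap f) (DInv qs)).
Proof.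
have [W [t [h [qt /Act_sound a]]]] := Act_total u (cid X).
exists W, t, qt, h; rewrite -a -deq_assoc (deq_map_comp (cid X)) deq_id_l.
by rewrite deq_inv_r deq_id_r; apply: deq_refl.
Qed.

(** Inclusion of the relations after refining the source. Strict inclusion would fail to be provable
    for [deq_inv_l], because left cancellation of a quasi-isomorphism holds only after a
    refinement. *)
Definition Act_le X Y (u v : dmor X Y) := forall Z (g : cmap Z X) (h : cmap Z Y),
  Act u g h -> exists W (t : cmap W Z),
    quasi_iso t /\ Act v (ccomp g t) (ccomp h t).

Lemma Act_le_strict X Y (u v : dmor X Y) :
  (forall Z (g : cmap Z X) (h : cmap Z Y), Act u g h -> Act v g h) -> Act_le u v.
Proof.
move=> uv Z g h /uv a; exists Z, (cid Z); split; last exact: Act_pre.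
exact: cid_quasi_iso.
Qed.

Lemma Act_le_trans X Y (u v w : dmor X Y) : Act_le u v -> Act_le v w -> Act_le u w.
Proof.
move=> uv vw Z g h /uv[W [t [qt /vw[V [s [qs a]]]]]].
exists V, (ccomp t s); split; first exact: qis_comp.
by apply: Act_hom a; apply: ccompA_sym.
Qed.

Lemma Act_le_comp X Y Z (v v' : dmor Y Z) (u u' : dmor X Y) :
  Act_le v v' -> Act_le u u' -> Act_le (DComp v u) (DComp v' u').
Proof.
move=> vv uu T g h [W [t [k [qt /uu[A [a [qa ua]]] b]]]].
have /vv[B [c [qc vb]]] := Act_pre a b.
exists B, (ccomp t (ccomp a c)); split; first by do 2?apply: qis_comp.
exists B, (cid B), (ccomp k (ccomp a c)); split; first exact: cid_quasi_iso.
  by apply: Act_hom (Act_pre c ua); apply: eq_homotopic.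
by apply: Act_hom vb; apply: eq_homotopic.
Qed.

Lemma Act_DComp X Y Z (v : dmor Y Z) (u : dmor X Y) T (g : cmap T X) k h :
  Act u g k -> Act v k h -> Act (DComp v u) g h.
Proof.
move=> a b; exists T, (cid T), k; split; first exact: cid_quasi_iso.
  by apply: Act_hom a; apply: eq_homotopic.
by apply: Act_hom b; apply: eq_homotopic.
Qed.

(** Induction on the presentation: composition and associativity need refinements to be pulled back,
    and the two relations for inverses need the two Ore conditions. *)
Lemma deq_Act_le X Y (u v : dmor X Y) : deq u v -> Act_le u v /\ Act_le v u.
Proof.
elim=> {X Y u v} [X Y u|X Y u v _ []|X Y u v w _ [a b] _ [c d]|
  X Y Z v v' u u' _ [a b] _ [c d]|X Y Z T w v u|X Y u|X Y u|X Y Z g f|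
  X Y f g fg|X Y s qs|X Y s qs].
- by split; apply: Act_le_strict.
- by [].
- by split; apply: Act_le_trans; eassumption.
- by split; apply: Act_le_comp.
- split=> A g h.
    move=> [B [t [k [qt [C [s [l [qs a b]]]] c]]]].
    exists C, (ccomp t s); split; first exact: qis_comp.
    apply: (Act_DComp (k := l)); first by apply: Act_hom a; [apply: ccompA_sym|apply: hR].
    apply: Act_DComp b _.
    by apply: Act_hom (Act_pre s c); [apply: hR|apply: ccompA_sym].
  move=> [B [t [k [qt a [C [s [l [qs b c]]]]]]]].
  exists C, (ccomp t s); split; first exact: qis_comp.
  apply: (Act_DComp (k := l)).
    apply: Act_DComp b; apply: Act_hom (Act_pre s a); [exact: ccompA_sym|exact: hR].
  by apply: Act_hom c; [apply: hR|apply: ccompA_sym].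
- split=> [A g h [B [t [k [qt a b]]]]|]; last first.
    by apply: Act_le_strict => A g h a; apply: Act_DComp a _; apply: eq_homotopic.
  exists B, t; split=> //; apply: Act_hom a; first exact: hR.
  by apply: (hT _ (hS b)); apply: eq_homotopic.
- split=> [A g h [B [t [k [qt a b]]]]|]; last first.
    by apply: Act_le_strict => A g h a; apply: Act_DComp a; apply: eq_homotopic.
  exists B, t; split=> //; apply: Act_hom b; last exact: hR.
  by apply: (hT a); apply: eq_homotopic.
- split=> [|A a h [B [t [k [qt b c]]]]].
    apply: Act_le_strict => A a h H; apply: (Act_DComp (k := ccomp f a)).
      exact: hR.
    by apply: (hT H); apply: ccompA_sym.
  exists B, t; split=> //=; apply: (hT c); apply: (hT (hC (hR g) b)).
  exact: eq_homotopic.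
- by split; apply: Act_le_strict => A a h H; apply: (hT H); apply/hC/hR => //; apply: hS.
- split=> [A g h [B [t [k [qt /= a b]]]]|]; last first.
    apply: Act_le_strict => A g h H.
    by apply: (Act_DComp (k := ccomp s g)) => //=; apply: hC H.
  (* From [s (h t)] homotopic to [s (g t)], the factor [s] cancels after a further refinement
     [t']. *)
  have [C [t' [qt' H]]] := ore_cancel qs (hT b a).
  exists C, (ccomp t t'); split=> /=; first exact: qis_comp.
  by apply: (hT (hA _ _ _)); apply: (hT H); apply: eq_homotopic.
- split=> [A g h [B [t [k [qt /= a b]]]]|A g h H].
    by exists B, t; split=> //=; apply: (hT b); apply: (hT a); apply: eq_homotopic.
  (* To pass through [DInv], [g] must first be lifted through [s]. *)
  have [B [t [k [qt a]]]] := ore_square g qs.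
  exists B, t; split=> //; apply: (Act_DComp (k := k)) => //=.
  by apply: hT (hS a); apply: hC => //; apply: (hT H); apply: eq_homotopic.
Qed.

(** [DMap f] carries the identity to [f]; after a refinement, so does [DMap g]. *)
Lemma deq_DMap X Y (f g : cmap X Y) : deq (DMap f) (DMap g) ->
  exists W (t : cmap W X), quasi_iso t /\ homotopic (ccomp f t) (ccomp g t).
Proof.
case/deq_Act_le=> H _; have [|W [t [qt a]]] := H X (cid X) f; first exact: eq_homotopic.
by exists W, t; split=> //; apply: (hT a); apply: eq_homotopic.
Qed.

End Fractions.

(** * Isomorphisms and equivalences *)

Local Open Scope tricat_scope.

Add Parametric Relation (T : tricat) (X Y : T) : (thom X Y) (@teq T X Y)
  reflexivity proved by (@teq_refl T X Y)
  symmetry proved by (@teq_sym T X Y)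
  transitivity proved by (@teq_trans T X Y) as teq_rel.
Add Parametric Morphism (T : tricat) (X Y Z : T) : (@tcomp T X Y Z)
  with signature (@teq T Y Z) ==> (@teq T X Y) ==> (@teq T X Z) as tcomp_mor.
Proof. by move=> *; apply: teq_comp. Qed.
Add Parametric Morphism (C D : tricat) (F : tfunctor C D) (X Y : C) :
    (@fmap C D F X Y)
  with signature (@teq C X Y) ==> (@teq D (F X) (F Y)) as fmap_mor.
Proof. by move=> *; apply: fmap_eq. Qed.

Section Categories.
Variable T : tricat.
Implicit Types X Y Z : T.

Definition iso X Y := exists u : thom X Y, tiso u.
(* Unlike [hom_trivial], this does not mention [tzero], so that every
   equivalence preserves it. *)
Definition hom_unique X Y := forall u v : thom X Y, u =~ v.

Lemma tiso_id X : tiso (tid X).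
Proof. by exists (tid X); split; apply: tcomp1l. Qed.

Lemma tiso_comp X Y Z (v : thom Y Z) (u : thom X Y) :
  tiso v -> tiso u -> tiso (v \o u).
Proof.
move=> [v' [v1 v2]] [u' [u1 u2]]; exists (u' \o v'); split.
  rewrite -tcompA (tcompA v') v1 tcomp1l; exact: u1.
rewrite -tcompA (tcompA u) u2 tcomp1l; exact: v2.
Qed.

Lemma iso_refl X : iso X X.
Proof. by exists (tid X); apply: tiso_id. Qed.
Lemma iso_sym X Y : iso X Y -> iso Y X.
Proof. by move=> [u [v [a b]]]; exists v, u. Qed.
Lemma iso_trans X Y Z : iso X Y -> iso Y Z -> iso X Z.
Proof. by move=> [u a] [v b]; exists (v \o u); apply: tiso_comp. Qed.

Lemma hom_unique_iso X X' Y Y' : iso X X' -> iso Y Y' ->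
  hom_unique X Y -> hom_unique X' Y'.
Proof.
move=> [a [a' [_ aa]]] [b [b' [_ bb]]] XY u v.
have H (w : thom X' Y') : w =~ b \o (b' \o (w \o a)) \o a'.
  by rewrite -!tcompA aa tcomp1r tcompA bb tcomp1l; apply: teq_refl.
by rewrite (H u) (H v) (XY (b' \o (u \o a)) (b' \o (v \o a))); apply: teq_refl.
Qed.

End Categories.

Section Functors.
Variables (C D : tricat) (F : tfunctor C D).

Lemma iso_functor (X Y : C) : iso X Y -> iso (F X) (F Y).
Proof.
move=> [u [v [a b]]]; exists (fmap F u), (fmap F v).
by rewrite -!fmap_comp a b !fmap_id; split; apply: teq_refl.
Qed.

Lemma hom_unique_reflect (G : tfunctor D C) (X Y : C) :
  nat_iso (compfunctor G F) (idfunctor C) ->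
  hom_unique (F X) (F Y) -> hom_unique X Y.
Proof.
move=> [t [tI tN]] FXY u v; have [t' [_ tt]] := tI X.
have /= Nu := tN X Y u; have /= Nv := tN X Y v.
rewrite -(tcomp1r u) -(tcomp1r v) -tt !tcompA -Nu -Nv.
by rewrite (FXY (fmap F u) (fmap F v)); apply: teq_refl.
Qed.

End Functors.

Section Equivalences.
Variables (C D : tricat) (F : tfunctor C D) (G : tfunctor D C).
Hypotheses (GF : nat_iso (compfunctor G F) (idfunctor C))
  (FG : nat_iso (compfunctor F G) (idfunctor D)).

Lemma iso_GF X : iso (G (F X)) X.
Proof. by have [t [tI _]] := GF; exists (t X); apply: tI. Qed.
Lemma iso_FG X : iso (F (G X)) X.
Proof. by have [t [tI _]] := FG; exists (t X); apply: tI. Qed.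

Lemma hom_unique_functor X Y : hom_unique X Y <-> hom_unique (F X) (F Y).
Proof.
split=> [XY|]; last exact: hom_unique_reflect GF.
apply: (hom_unique_reflect FG); apply: hom_unique_iso XY; exact/iso_sym/iso_GF.
Qed.

End Equivalences.

(** * Shifts in the derived category *)

Section DerivedCategory.
Variable R : pzRingType.
Implicit Types X Y Z W N : cplx R.

Lemma qis_tiso X Y (s : cmap X Y) : quasi_iso s -> @tiso (Db R) X Y (DMap s).
Proof. by move=> qs; exists (DInv qs); split; [apply: deq_inv_l | apply: deq_inv_r]. Qed.

Lemma qis_iso X Y (s : cmap X Y) : quasi_iso s -> @iso (Db R) X Y.
Proof. by move=> /qis_tiso; exists (DMap s). Qed.

Lemma czero_comp X Y Z (u : dmor X Y) :
  deq (DComp (DMap (czero Y Z)) u) (DMap (czero X Z)).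
Proof.
have H X' Y' (f : cmap X' Y') :
    deq (DComp (DMap (czero Y' Z)) (DMap f)) (DMap (czero X' Z)).
  by rewrite -deq_map_comp; apply: DMap_eq.
elim: {X Y} u Z H => [X Y f|X Y s qs|X Y T v IHv u IHu] Z H; first exact: H.
  (* Zero is written as a zero map after [s], so that [s] cancels against its formal inverse. *)
  rewrite -(H _ _ s) -deq_assoc deq_inv_r deq_id_r; exact: deq_refl.
by rewrite deq_assoc IHv // IHu //; apply: deq_refl.
Qed.

Lemma comp_czero X Y Z (u : dmor Y Z) :
  deq (DComp u (DMap (czero X Y))) (DMap (czero X Z)).
Proof.
have H Y' Z' (f : cmap Y' Z') :
    deq (DComp (DMap f) (DMap (czero X Y'))) (DMap (czero X Z')).
  by rewrite -deq_map_comp; apply: DMap_eq => i x /=; rewrite linear0.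
elim: {Y Z} u X H => [Y Z f|Y Z s qs|Y Z T v IHv u IHu] X H; first exact: H.
  rewrite -(H _ _ s) deq_assoc deq_inv_l deq_id_l; exact: deq_refl.
by rewrite -deq_assoc IHu // IHv //; apply: deq_refl.
Qed.

(** The zero endomorphism of an acyclic complex is a quasi-isomorphism; composing it with its
    inverse gives the identity. *)
Lemma acyc_id X : acyc X -> deq (DMap (cid X)) (DMap (czero X X)).
Proof.
move=> aX; have q : quasi_iso (czero X X) by apply: acyc_qis.
by rewrite -(deq_inv_l q) comp_czero; apply: deq_refl.
Qed.

Lemma acyc_factor X Y Z (v : dmor Y Z) (u : dmor X Y) : acyc Y ->
  deq (DComp v u) (DMap (czero X Z)).
Proof.
move=> /acyc_id e.
by rewrite -(deq_id_l u) e czero_comp comp_czero; apply: deq_refl.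
Qed.

Lemma hom_trivialP X Y : @hom_trivial (Db R) X Y <-> @hom_unique (Db R) X Y.
Proof.
split=> [H u v|H u]; last exact: H.
by apply: teq_trans (H u) _; apply/teq_sym/H.
Qed.

Lemma acyc_hom_unique_l X Y : acyc X -> @hom_unique (Db R) X Y.
Proof.
move=> aX; apply/hom_trivialP => u; apply: teq_trans (teq_sym (tcomp1r u)) _.
exact: acyc_factor.
Qed.
Lemma acyc_hom_unique_r X Y : acyc Y -> @hom_unique (Db R) X Y.
Proof.
move=> aX; apply/hom_trivialP => u; apply: teq_trans (teq_sym (tcomp1l u)) _.
exact: acyc_factor.
Qed.

Lemma cshift_homotopic n X Y (f g : cmap X Y) : homotopic f g ->
  homotopic (cshift n f) (cshift n g).
Proof.
move=> /homotopic_at[h hP].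
(* For odd [n] the differentials change sign, so the homotopy must as well. *)
exists (fun i j => if odd `|n| then lin (linearP (\- h (i + n) (j + n)))
                   else h (i + n) (j + n)) => i x.
have /= -> := hP (i - 1 + n) (i + n) (i + 1 + n) x; [|lia|lia].
rewrite /= /shift_d; case: odd => //=.
by rewrite !linearN /= !opprK.
Qed.

(** [dshift] is defined on formal composites, so its descent to morphisms has to be checked relation
    by relation. *)
Lemma dshift_deq n X Y (u v : dmor X Y) : deq u v -> deq (dshift n u) (dshift n v).
Proof.
have I Z : deq (DMap (cshift n (cid Z))) (DMap (cid (shift n Z))) by apply: DMap_eq.
elim=> {X Y u v} /=.
- by move=> *; apply: deq_refl.
- by move=> X Y u v _ ->; apply: deq_refl.
- by move=> X Y u v w _ -> _ ->; apply: deq_refl.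
- by move=> X Y Z v v' u u' _ -> _ ->; apply: deq_refl.
- by move=> *; apply: deq_assoc.
- by move=> X Y u; rewrite I; apply: deq_id_l.
- by move=> X Y u; rewrite I; apply: deq_id_r.
- by move=> X Y Z g f; rewrite -deq_map_comp; apply: DMap_eq.
- by move=> X Y f g fg; apply/DMap_hom/cshift_homotopic.
- by move=> X Y s qs; rewrite I; apply: deq_inv_l.
- by move=> X Y s qs; rewrite I; apply: deq_inv_r.
Qed.

Lemma csum_homotopic X Y X' Y' (f f' : cmap X X') (g g' : cmap Y Y') :
  homotopic f f' -> homotopic g g' -> homotopic (csum f g) (csum f' g').
Proof.
move=> [h hP] [k kP].
have Hl i j : linear (fun z : dsum X Y i => (h i j z.1, k i j z.2) : dsum X' Y' j).
  by move=> a u v; congr (_, _); rewrite /= linearP.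
exists (fun i j => lin (@Hl i j)) => i [x y].
by congr (_, _); [apply: hP | apply: kP].
Qed.

Lemma dsuml_deq Z X Y (u v : dmor X Y) : deq u v -> deq (dsuml Z u) (dsuml Z v).
Proof.
have I T : deq (DMap (csum (cid T) (cid Z))) (DMap (cid (dsum T Z))).
  by apply: DMap_eq => i [].
elim=> {X Y u v} /=.
- by move=> *; apply: deq_refl.
- by move=> X Y u v _ ->; apply: deq_refl.
- by move=> X Y u v w _ -> _ ->; apply: deq_refl.
- by move=> X Y T v v' u u' _ -> _ ->; apply: deq_refl.
- by move=> *; apply: deq_assoc.
- by move=> X Y u; rewrite I; apply: deq_id_l.
- by move=> X Y u; rewrite I; apply: deq_id_r.
- by move=> X Y T g f; rewrite -deq_map_comp; apply: DMap_eq.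
- by move=> X Y f g fg; apply/DMap_hom/csum_homotopic/homotopic_refl.
- by move=> X Y s qs; rewrite I; apply: deq_inv_l.
- by move=> X Y s qs; rewrite I; apply: deq_inv_r.
Qed.

Lemma dsumr_deq Z X Y (u v : dmor X Y) : deq u v -> deq (dsumr Z u) (dsumr Z v).
Proof.
have I T : deq (DMap (csum (cid Z) (cid T))) (DMap (cid (dsum Z T))).
  by apply: DMap_eq => i [].
elim=> {X Y u v} /=.
- by move=> *; apply: deq_refl.
- by move=> X Y u v _ ->; apply: deq_refl.
- by move=> X Y u v w _ -> _ ->; apply: deq_refl.
- by move=> X Y T v v' u u' _ -> _ ->; apply: deq_refl.
- by move=> *; apply: deq_assoc.
- by move=> X Y u; rewrite I; apply: deq_id_l.
- by move=> X Y u; rewrite I; apply: deq_id_r.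
- by move=> X Y T g f; rewrite -deq_map_comp; apply: DMap_eq.
- by move=> X Y f g fg; apply/DMap_hom/csum_homotopic/fg/homotopic_refl.
- by move=> X Y s qs; rewrite I; apply: deq_inv_l.
- by move=> X Y s qs; rewrite I; apply: deq_inv_r.
Qed.

Lemma dadd_deq X Y (u u' v v' : dmor X Y) :
  deq u u' -> deq v v' -> deq (dadd u v) (dadd u' v').
Proof.
move=> /(dsuml_deq X) uu /(dsumr_deq Y) vv; rewrite /dadd uu vv; exact: deq_refl.
Qed.

Lemma shift_iso n X Y : @iso (Db R) X Y -> @iso (Db R) (shift n X) (shift n Y).
Proof.
have I Z : deq (DMap (cshift n (cid Z))) (DMap (cid (shift n Z))) by apply: DMap_eq.
move=> [u [v [a b]]]; exists (dshift n u), (dshift n v); split.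
  exact: deq_trans (dshift_deq n a) (I _).
exact: deq_trans (dshift_deq n b) (I _).
Qed.

Lemma odd_absz_add (m n : int) : odd `|m + n| = odd `|m| (+) odd `|n|.
Proof. lia. Qed.

Lemma deg_linear X (i j : int) : linear (fun x : X i => deg_id j x).
Proof. by move=> a u v; rewrite /= deg_idD deg_idZ. Qed.

Section ShiftShift.
Variables (X : cplx R) (n m k : int).
Hypothesis mnk : m + n = k.

(** The degrees [i + n + m] and [i + k] are only provably equal, so the comparison of iterated
    shifts is a [deg_id] map. The signs match because parity is additive. *)
Lemma shift_shift_d (i j : int) (x : X (i + n + m)) : i + 1 = j ->
  @deg_id R X (j + n + m) (j + k) (cdf (shift n (shift m X)) i j x)
    = cdf (shift k X) i j (deg_id (i + k) x).
Proof.
move=> ij; rewrite /= /shift_d -mnk odd_absz_add /= /shift_d.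
rewrite (deg_id_d (j := j + n + m)); [|lia|lia].
by do 2!case: odd; rewrite //= deg_idN ?opprK // deg_idN ?opprK.
Qed.

Definition cshift_shift : cmap (shift n (shift m X)) (shift k X) :=
  @cmap_of R (shift n (shift m X)) (shift k X)
    (fun i => lin (@deg_linear X (i + n + m) (i + k)))
    (fun i j x ij => shift_shift_d x ij).

Lemma cshift_shift_qis : quasi_iso cshift_shift.
Proof.
apply: qisP => i x cx.
  move/bnd_shift/bnd_deg => H; apply/bnd_shift/bnd_shift/H; lia.
exists (deg_id (i + n + m) (x : X (i + k))); split.
  by apply/cyc_shift/cyc_shift/cyc_deg; [lia | apply/cyc_shift].
by apply: bnd_eq; rewrite /= deg_idK ?subrr //; lia.
Qed.

End ShiftShift.

Lemma shift_shift_iso n m k X : m + n = k ->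
  @iso (Db R) (shift n (shift m X)) (shift k X).
Proof. by move=> mnk; apply: (qis_iso (cshift_shift_qis X mnk)). Qed.

Section ShiftInverse.
Variables (n m : int).
Hypothesis mn0 : m + n = 0.

Lemma unshift_d X (i j : int) (x : X (i + n + m)) : i + 1 = j ->
  @deg_id R X (j + n + m) j (cdf (shift n (shift m X)) i j x) = cdf X i j (deg_id i x).
Proof.
move=> ij; rewrite (deg_id_d (j := j + n + m)) /=; [|lia|lia].
have := odd_absz_add m n; rewrite mn0 /= /shift_d /= /shift_d.
by do 2!case: odd => //; rewrite opprK.
Qed.

Definition cunshift X : cmap (shift n (shift m X)) X :=
  @cmap_of R (shift n (shift m X)) X
    (fun i => lin (@deg_linear X (i + n + m) i)) (fun i j x ij => unshift_d x ij).

Lemma cunshift_qis X : quasi_iso (cunshift X).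
Proof.
apply: qisP => i x cx.
  move/bnd_deg => H; apply/bnd_shift/bnd_shift/H; lia.
exists (deg_id (i + n + m) (x : X i)); split.
  by apply/cyc_shift/cyc_shift/cyc_deg; [lia | ].
by apply: bnd_eq; rewrite /= deg_idK ?subrr //; lia.
Qed.

(** Naturality is plain for chain maps; for a formal inverse it follows after cancelling the shifted
    quasi-isomorphism. *)
Lemma cunshift_nat X Y (u : dmor X Y) :
  deq (DComp (DMap (cunshift Y)) (dshift n (dshift m u)))
    (DComp u (DMap (cunshift X))).
Proof.
elim: {X Y} u => [X Y f|X Y s qs|X Y Z v IHv u IHu] /=.
- by rewrite -!deq_map_comp; apply: DMap_eq => i x /=; rewrite deg_id_map.
- apply: (deq_cancel_r (cshift_quasi_iso n (cshift_quasi_iso m qs))).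
  rewrite -deq_assoc deq_inv_l deq_id_r -deq_assoc.
  rewrite -deq_map_comp.
  have -> : deq (DMap (ccomp (cunshift Y) (cshift n (cshift m s)))) 
    (DMap (ccomp s (cunshift X))) by apply: DMap_eq => i x /=; rewrite deg_id_map.
  by rewrite deq_map_comp deq_assoc deq_inv_l deq_id_l; apply: deq_refl.
- by rewrite deq_assoc IHv -deq_assoc IHu deq_assoc; apply: deq_refl.
Qed.

Lemma dshift_faithful X Y (u v : dmor X Y) : deq (dshift m u) (dshift m v) -> deq u v.
Proof.
move=> /(dshift_deq n) uv; apply: (deq_cancel_r (cunshift_qis X)).
by rewrite -!cunshift_nat uv; apply: deq_refl.
Qed.

End ShiftInverse.

Lemma unshift_iso n X : @iso (Db R) (shift n (shift (- n) X)) X.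
Proof. exact: (qis_iso (cunshift_qis (addNr n) X)). Qed.

Lemma shift0_iso X : @iso (Db R) (shift 0 X) X.
Proof.
apply: iso_trans (unshift_iso 0 X).
by apply: iso_sym; apply: shift_shift_iso; rewrite oppr0.
Qed.

Lemma hom_unique_shift n X Y :
  @hom_unique (Db R) X Y -> @hom_unique (Db R) (shift n X) (shift n Y).
Proof.
move=> XY u v; apply: (dshift_faithful (n := n) (m := - n)); first exact: addNr.
move: (dshift _ u) (dshift _ v).
have H Z : @iso (Db R) Z (shift (- n) (shift n Z)).
  by apply: iso_sym; have := unshift_iso (- n) Z; rewrite opprK.
exact: (hom_unique_iso (H X) (H Y) XY).
Qed.

Lemma hom_unique_shiftr n X Y :
  @hom_unique (Db R) X (shift n Y) <-> @hom_unique (Db R) (shift (- n) X) Y.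
Proof.
split=> [/(hom_unique_shift (n := - n))|/(hom_unique_shift (n := n))];
  apply: hom_unique_iso; try exact: iso_refl; last exact: unshift_iso.
by have := unshift_iso (- n) Y; rewrite opprK.
Qed.

(** The shifts sit on [N], unlike in [ev_orth], so that closure properties in [X] reduce to
    statements about morphisms out of one fixed object. *)
Definition perp N X := exists n : nat, forall i : int, (n < `|i|)%N ->
  @hom_unique (Db R) (shift i N) X.

Lemma ev_orthP N X : @ev_orth (Db R) N X <-> perp N X.
Proof.
split=> -[n H]; exists n => i ni.
  by have := H (- i); rewrite abszN => /(_ ni)/hom_trivialP/hom_unique_shiftr; rewrite opprK.
by apply/hom_trivialP/hom_unique_shiftr/H; rewrite abszN.
Qed.

End DerivedCategory.

(** * Truncation *)

Section Truncation.
Variables (R : pzRingType) (k : int).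
Implicit Types X Y Z W N : cplx R.

(* All of [X i] for [i < k], the cycles for [i = k], and 0 for [i > k]: a uniform
   description that spares a case distinction on [i] in the type of [trunc]. *)
Definition trunc_pred X (i : int) : {pred X i} := fun x =>
  ((k <= i)%R ==> (cdf X i (i + 1) x == 0)) && ((k < i)%R ==> (x == 0)).

Lemma trunc_predP X i (x : X i) :
  reflect ((k <= i -> cyc x) /\ (k < i -> x = 0)) (x \in @trunc_pred X i).
Proof.
apply: (iffP andP) => [[/implyP a /implyP b]|[a b]]; split.
- by move=> /a/eqP; apply: cycP.
- by move=> /b/eqP.
- by apply/implyP => /a->.
- by apply/implyP => /b->.
Qed.

Lemma trunc_submod X i : submod_closed (@trunc_pred X i).
Proof.
split; first by apply/trunc_predP; split=> // _; apply: cyc0.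
move=> a x y /trunc_predP[x1 x2] /trunc_predP[y1 y2]; apply/trunc_predP; split.
  by move=> ki j; rewrite linearP x1 // y1 // scaler0 addr0.
by move=> ki; rewrite x2 // y2 // scaler0 addr0.
Qed.

HB.instance Definition _ X i :=
  GRing.isSubmodClosed.Build R (X i) (@trunc_pred X i) (@trunc_submod X i).

Record trunc_ob X i := TruncOb { trunc_val :> X i; _ : trunc_val \in @trunc_pred X i }.

HB.instance Definition _ X i := [isSub for @trunc_val X i].
HB.instance Definition _ X i := [Choice of trunc_ob X i by <:].
HB.instance Definition _ X i := [SubChoice_isSubLmodule of trunc_ob X i by <:].

Section Restriction.
Variables (X Y : cplx R) (i j : int) (f : {linear X i -> Y j}).
Hypothesis fP : forall x, x \in @trunc_pred X i -> f x \in @trunc_pred Y j.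

Definition trunc_restr_f (x : trunc_ob X i) : trunc_ob Y j :=
  TruncOb (fP (valP x)).

Lemma trunc_restr_linear : linear trunc_restr_f.
Proof. by move=> a x y; apply: val_inj; rewrite /= !linearP. Qed.

Definition trunc_restr : {linear trunc_ob X i -> trunc_ob Y j} :=
  lin trunc_restr_linear.

End Restriction.

Lemma trunc_d_mem X i j (x : X i) :
  x \in @trunc_pred X i -> cdf X i j x \in @trunc_pred X j.
Proof.
move=> /trunc_predP[x1 x2]; apply/trunc_predP; split=> [_|kj]; first by apply/bnd_cyc/bnd_d.
(* Either [x] is a cycle, or [i < k < j] excludes [j = i + 1]. *)
have [ki|ik] := lerP k i; first by rewrite x1.
by rewrite cdf_shape //; lia.
Qed.

Lemma trunc_map_mem X Y (f : cmap X Y) i (x : X i) :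
  x \in @trunc_pred X i -> f i x \in @trunc_pred Y i.
Proof.
move=> /trunc_predP[x1 x2]; apply/trunc_predP; split=> [/x1|/x2->]; first exact: cyc_map.
by rewrite linear0.
Qed.

Hypothesis noethR : left_noetherian R.

(** The Noetherian hypothesis enters through the cycles in degree [k], a submodule of [X k]. *)
Lemma trunc_fin_gen X i : fin_gen (trunc_ob X i).
Proof.
have [n [g gP]] := cob_fg X i.
have [||||m [h [hA hP]]] := @noetherian_span R (X i) n g (fun x => x \in @trunc_pred X i).
- exact: noethR.
- exact: rpred0.
- by move=> a x y ax ay; rewrite rpredD ?rpredZ.
- by move=> x _; apply: gP.
exists m, (fun i => TruncOb (hA i)) => x; have [c xc] := hP _ (valP x).
exists c; apply: val_inj; rewrite xc (linear_sum (val : {linear trunc_ob X i -> X i})).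
by apply: eq_bigr => l _; rewrite linearZ.
Qed.

Lemma trunc_bounded X : exists n : nat, forall i, (n < `|i|)%N ->
  forall x : trunc_ob X i, x = 0.
Proof.
have [n H] := cob_bounded X; exists n => i ni x; apply: val_inj; exact: H.
Qed.

Definition trunc X : cplx R.
Proof.
refine (@Cplx R (fun i => trunc_ob X i)
  (fun i j => trunc_restr (@trunc_d_mem X i j)) _ _ (trunc_fin_gen X) (trunc_bounded X)).
- by move=> i j ij x; apply: val_inj; rewrite /= cdf_shape.
- by move=> i j l x; apply: val_inj; rewrite /= cdf_sq.
Defined.

Lemma trunc_in_d X i j (x : trunc X i) :
  val (cdf (trunc X) i j x) = cdf X i j (val x).
Proof. by []. Qed.

Definition trunc_in X : cmap (trunc X) X :=
  @Cmap R (trunc X) X (fun i => (val : trunc_ob X i -> X i)) (@trunc_in_d X).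

Lemma trunc_map_d X Y (f : cmap X Y) i j (x : trunc X i) :
  trunc_restr (@trunc_map_mem X Y f j) (cdf (trunc X) i j x)
  = cdf (trunc Y) i j (trunc_restr (@trunc_map_mem X Y f i) x).
Proof. by apply: val_inj; rewrite /= cmf_d. Qed.

Definition trunc_map X Y (f : cmap X Y) : cmap (trunc X) (trunc Y) :=
  @Cmap R (trunc X) (trunc Y) (fun i => trunc_restr (@trunc_map_mem X Y f i))
    (trunc_map_d f).

(** [aisle] and [coaisle] are D^{<=k} and D^{>k} for the standard t-structure. *)
Definition aisle X := forall i, k < i -> acyc_at X i.
Definition coaisle X := forall i, i <= k -> acyc_at X i.

Lemma cyc_trunc X i (x : trunc X i) : cyc (val x) <-> cyc x.
Proof.
split=> cx j; first by apply: val_inj; rewrite trunc_in_d cx.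
by rewrite -trunc_in_d cx.
Qed.

Lemma bnd_trunc X i (x : trunc X i) : i <= k -> bnd (val x) -> bnd x.
Proof.
move=> ik /(bndP (j := i - 1)) [|y xy]; first by lia.
have yP : y \in @trunc_pred X (i - 1) by apply/trunc_predP; split=> ?; exfalso; lia.
by exists (i - 1), (TruncOb yP); apply: val_inj.
Qed.

Lemma trunc_above X i (x : trunc X i) : k < i -> x = 0.
Proof.
by move=> ki; apply: val_inj; case: x => x /= /trunc_predP[_ ->].
Qed.

Lemma trunc_lift X i (x : X i) : i <= k -> cyc x -> exists y : trunc X i, x = val y.
Proof.
move=> ik cx; have xP : x \in @trunc_pred X i.
  by apply/trunc_predP; split=> // ?; exfalso; lia.
by exists (TruncOb xP).
Qed.

Lemma acyc_trunc X : coaisle X -> acyc (trunc X).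
Proof.
move=> aX i x cx; have [ik|ki] := lerP i k; last first.
  by apply/bnd_eq/trunc_above.
by apply: bnd_trunc => //; apply: (aX _ ik); apply/cyc_trunc.
Qed.

Lemma trunc_in_qis X : aisle X -> quasi_iso (trunc_in X).
Proof.
move=> aX; apply: qisP => i x cx.
  have [ik|ki] := lerP i k; first exact: bnd_trunc.
  by move=> _; apply/bnd_eq/trunc_above.
have [ik|ki] := lerP i k; last first.
  exists 0; split; first exact: cyc0.
  by rewrite linear0 sub0r; apply/bndN/(aX _ ki).
have [y xy] := trunc_lift ik cx; exists y; split.
  by apply/cyc_trunc; rewrite -xy.
by apply: bnd_eq; rewrite xy subrr.
Qed.

(** The truncation keeps cohomology up to degree [k]; for [i = k] the injectivity needed in degree
    [k + 1] holds because the truncation vanishes there. *)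
Lemma coaisle_cone_trunc X : coaisle (cone (trunc_in X)).
Proof.
move=> i ik; apply: acyc_at_cone => [x cx bx|y cy].
  have [ik1|ki] := lerP (i + 1) k; first exact: bnd_trunc.
  exact/bnd_eq/trunc_above.
have [x xy] := trunc_lift ik cy; exists x; split.
  by apply/cyc_trunc; rewrite -xy.
by apply: bnd_eq; rewrite xy subrr.
Qed.

(** Represent the morphism by a fraction with source [W] in D^{<=k}. Precomposing with
    [trunc W -> W], a quasi-isomorphism, makes the numerator factor through the acyclic complex
    [trunc Z]. *)
Lemma aisle_coaisle X Z : aisle X -> coaisle Z -> @hom_unique (Db R) X Z.
Proof.
move=> aX aZ; apply/hom_trivialP => u.
have [W [s [qs [g ug]]]] := fraction u.
have aW : aisle W by move=> i ki; apply/(qis_acyc_at i qs)/aX.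
suff g0 : deq (DMap g) (DMap (czero W Z)).
  by apply: deq_trans ug _; rewrite g0 czero_comp; apply: deq_refl.
apply: (deq_cancel_r (trunc_in_qis aW)); rewrite czero_comp -deq_map_comp.
have -> : deq (DMap (ccomp g (trunc_in W)))
    (DMap (ccomp (trunc_in Z) (trunc_map g))) by apply: DMap_eq.
by rewrite deq_map_comp; apply: acyc_factor; apply: acyc_trunc.
Qed.

(** Test the hypothesis on the cone of [trunc_in X]: the map from [X] to it vanishes, hence is
    null-homotopic after a quasi-isomorphism [t]. *)
Lemma aisle_of_orth X : (forall Z, coaisle Z -> @hom_unique (Db R) X Z) -> aisle X.
Proof.
move=> H i ki x cx.
have /deq_DMap[W [t [qt [h hP]]]] : deq (DMap (cone_in (trunc_in X))) (DMap (czero _ _)).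
  exact: (H _ (coaisle_cone_trunc (X := X))).
have [w [cw wx]] := qisS qt cx.
have := hP i w; rewrite /= cw !linear0 !addr0 /cone_d /=.
case: (h i (i - 1) w) => a b [/= a0 tb].
(* Above degree [k] the truncation is zero, so the homotopy lands in [X] alone and exhibits [t i w]
   as a boundary. *)
have /eqP : a = 0 by apply: trunc_above; lia.
move=> /eqP az; move: tb; rewrite az deg_id0 add0r => tb.
rewrite -[x](subKr (t i w)); apply: bndB wx; rewrite tb; exact: bnd_d.
Qed.

End Truncation.

(** * Cones and thick subcategories *)

Section Cones.
Variable R : pzRingType.
Implicit Types X Y Z W N : cplx R.

Lemma ddist_cone X Y (f : cmap X Y) :
  @ddist R X Y (cone f) (DMap f) (DMap (cone_in f)) (DMap (cone_out f)).
Proof.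
have I Z : diso (DMap (cid Z)) by exists (DMap (cid Z)); rewrite -deq_map_comp;
  split; apply: DMap_eq.
exists X, Y, f, (DMap (cid X)), (DMap (cid Y)), (DMap (cid (cone f))).
by split; split=> //; rewrite /= -!deq_map_comp; apply: DMap_eq.
Qed.

Section Rotation.
Variables (X Y : cplx R) (f : cmap X Y).

Lemma rot_linear i : linear (fun z : cone (cone_in f) i => z.2.1 : X (i + 1)).
Proof. by []. Qed.

Lemma rot_d (i j : int) (z : cone (cone_in f) i) : i + 1 = j ->
  lin (@rot_linear j) (cdf (cone (cone_in f)) i j z)
  = cdf (shift 1 X) i j (lin (@rot_linear i) z).
Proof.
by move=> ij; rewrite /= deg_id_cone_in /= add0r.
Qed.

Definition rot : cmap (cone (cone_in f)) (shift 1 X) :=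
  @cmap_of R (cone (cone_in f)) (shift 1 X) (fun i => lin (@rot_linear i)) rot_d.

(** The two copies of [Y] in the double cone cancel. This replaces rotation of triangles below. *)
Lemma rot_qis : quasi_iso rot.
Proof.
apply: qisP => i.
  move=> [y1 [x y]] cz; have /= := cz (i + 1).
  rewrite /cone_d /= deg_id_cone_in !deg_idE /= => -[/= dy1 dx fx].
  move/bnd_shift/(bndP (j := i - 1 + 1)) => [|a /= xa]; first by lia.
  have yE : y1 = - f (i + 1) x - cdf Y i (i + 1) y.
    by rewrite -[LHS]subr0 -fx deg_idE; zmod.
  exists (i - 1), (deg_id _ (y + deg_id i (f _ a)), (- a, 0)).
  rewrite /= /cone_d /= deg_id_cone_in /=; congr (_, (_, _)) => /=.
  - rewrite (deg_id_d (j := i + 1)) //; last by lia.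
    rewrite deg_idE linearD /= (deg_id_d (j := i + 1)) //; last by lia.
    by rewrite deg_idE -cmf_d -xa yE; zmod.
  - by rewrite linearN /= -xa; zmod.
  - by rewrite deg_idK ?linearN /= ?deg_idN ?linear0; [zmod|lia].
move=> x /cyc_shift cx; exists (- f _ x, (x, 0)); split; last exact/bnd_eq/subrr.
apply: (cycP erefl); rewrite /= /cone_d /= deg_id_cone_in /= !deg_idE.
congr (_, (_, _)); rewrite /= ?linearN /= -?cmf_d ?cx ?linear0 ?deg_idE; zmod.
Qed.

End Rotation.

(* Octahedral axiom: [cone a -> cone (b a) -> cone b] is distinguished. *)
Section Octahedron.
Variables (A B C : cplx R) (a : cmap A B) (b : cmap B C).

Lemma octa_linear i : linear (fun z : cone a i => (z.1, b i z.2) : cone (ccomp b a) i).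
Proof. by move=> c u v; congr (_, _); rewrite /= linearP. Qed.

Lemma octa_d (i j : int) (z : cone a i) : i + 1 = j ->
  lin (@octa_linear j) (cdf (cone a) i j z)
  = cdf (cone (ccomp b a)) i j (lin (@octa_linear i) z).
Proof.
by move=> ij; congr (_, _); rewrite /= linearD /= deg_id_map cmf_d.
Qed.

Definition octa : cmap (cone a) (cone (ccomp b a)) :=
  @cmap_of R (cone a) (cone (ccomp b a)) (fun i => lin (@octa_linear i)) octa_d.

Lemma octa_out_linear i :
  linear (fun z : cone octa i => (z.1.2 + a (i + 1) z.2.1, z.2.2) : cone b i).
Proof.
move=> c u v; congr (_, _) => /=; rewrite linearP /= scalerDr; zmod.
Qed.

Lemma octa_out_d (i j : int) (z : cone octa i) : i + 1 = j ->
  lin (@octa_out_linear j) (cdf (cone octa) i j z)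
  = cdf (cone b) i j (lin (@octa_out_linear i) z).
Proof.
move=> <-; case: z => [[a2 b1] [a1 c]].
rewrite /= /cone_d /= !deg_idE; congr (_, _) => /=.
  by rewrite !linearD !linearN /= !cmf_d; zmod.
by rewrite linearD /=; zmod.
Qed.

Definition octa_out : cmap (cone octa) (cone b) :=
  @cmap_of R (cone octa) (cone b) (fun i => lin (@octa_out_linear i)) octa_out_d.

(** The two copies of [A] in [cone octa] cancel, leaving the cone of [b]. *)
Lemma octa_out_qis : quasi_iso octa_out.
Proof.
apply: qisP => i.
  move=> [[a2 b1] [a1 c]] cz; have /= := cz (i + 1).
  rewrite /cone_d /= !deg_idE => -[/= _ _ a2E _].
  case/(bndP (j := i - 1)) => [|[b2 c'] /= [bE cE]]; first by lia.
  exists (i - 1), ((deg_id _ a1, b2), (0, c')); rewrite /= /cone_d /=.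
  congr (_, _, (_, _)) => /=.
  - by rewrite opprK (deg_id_d (j := i + 1 + 1)) ?deg_idE; [apply: subr0_eq|lia|].
  - have -> : b1 = - cdf B (i - 1 + 1) (i + 1) b2 - a (i + 1) a1 by rewrite -bE; zmod.
    by rewrite deg_id_map deg_id_id ?deg_idE; [zmod|lia].
  - rewrite deg_id_cone /= linear0 oppr0 addr0 deg_id_id ?deg_idE //; lia.
  - by rewrite deg_id_cone /= !linear0 deg_id0 add0r.
move=> [b1 c] cz; have /= := cz (i + 1); rewrite /cone_d /= !deg_idE => -[/= db bc].
exists ((0, b1), (0, c)); split; last first.
  by apply: bnd_eq; rewrite /= linear0 addr0 subrr.
apply: (cycP erefl); rewrite /= /cone_d /= !deg_idE.
congr (_, _, (_, _)) => /=; rewrite ?linear0 ?deg_id0 ?add0r ?oppr0 ?add0r ?db //.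
Qed.

End Octahedron.

Lemma cone_in_qis X Y (f : cmap X Y) : acyc X -> quasi_iso (cone_in f).
Proof.
move=> aX; apply: qisP => i.
  move=> y cy /(bndP (j := i - 1)) [|[a b] [/= da ->]]; first by lia.
  apply: bndD (bnd_d _ _); apply/bnd_deg; first by lia.
  apply/bnd_map/aX/(cycP (j := i + 1)); first by lia.
  by apply/eqP; rewrite -oppr_eq0 -da.
move=> [x y] cz; have /= := cz (i + 1); rewrite /cone_d /= !deg_idE => -[/= dx fx].
case: (aX (i + 1) x) => [|j].
  by apply: (cycP erefl); apply/eqP; rewrite -oppr_eq0 dx.
move/(ex_intro _ j)/(bndP (j := i - 1 + 1)) => [|a xa]; first by lia.
exists (y + deg_id i (f _ a)); split.
  apply: (cycP erefl); rewrite linearD /= (deg_id_d (j := i + 1)) ?deg_idE; [|lia|by []].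
  by rewrite -cmf_d -xa [LHS]addrC.
exists (i - 1), (a, 0); congr (_, _) => /=; last by rewrite linear0; zmod.
by rewrite -xa sub0r.
Qed.

(** A null-homotopy [h] splits the cone: [x] goes to [(x, - h x)], a section of [cone_out], and
    [(x, y)] goes to [y + h x], a retraction of [cone_in]. *)
Lemma cone_null X Y (f : cmap X Y) : homotopic f (czero X Y) ->
  @is_direct_sum (Db R) (shift 1 X) Y (cone f).
Proof.
move=> /homotopic_at[h hP].
have {}hP i j x : i + 1 = j ->
    f i x = cdf Y (i - 1) i (h i (i - 1) x) + h j i (cdf X i j x).
  by move=> ij; rewrite -(hP (i - 1) i j) ?subr0 //; lia.
have iXl i : linear (fun x : shift 1 X i => (x, - h (i + 1) i x) : cone f i).
  by move=> a u v; congr (_, _); rewrite /= linearP opprD scalerN.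
have pYl i : linear (fun z : cone f i => z.2 + h (i + 1) i z.1 : Y i).
  by move=> a u v; rewrite /= linearP scalerDr; zmod.
have hE i x : f (i + 1) x =
    cdf Y i (i + 1) (h (i + 1) i x) + h (i + 1 + 1) (i + 1) (cdf X (i + 1) (i + 1 + 1) x).
  by rewrite (hP (i + 1) (i + 1 + 1)) //; have -> : i + 1 - 1 = i by lia.
have iXc (i j : int) (x : shift 1 X i) : i + 1 = j ->
    lin (@iXl j) (cdf (shift 1 X) i j x) = cdf (cone f) i j (lin (@iXl i) x).
  move=> <-; congr (_, _) => /=.
  by rewrite deg_idE hE /shift_d /= !linearN /=; zmod.
have pYc (i j : int) (z : cone f i) : i + 1 = j ->
    lin (@pYl j) (cdf (cone f) i j z) = cdf Y i j (lin (@pYl i) z).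
  move=> <-; rewrite /= deg_idE hE !linearD !linearN /=; zmod.
pose iX := @cmap_of R (shift 1 X) (cone f) (fun i => lin (@iXl i)) iXc.
pose pY := @cmap_of R (cone f) Y (fun i => lin (@pYl i)) pYc.
exists (DMap iX), (DMap (cone_in f)), (DMap (cone_out f)), (DMap pY).
split; rewrite /= ?/dadd /= -!deq_map_comp; apply: DMap_eq => i.
- by [].
- by move=> y; rewrite /= linear0 addr0.
- by move=> x; rewrite /= addNr.
- by [].
- by move=> [x y]; congr (_, _); rewrite /=; zmod.
Qed.

End Cones.

(** * Closure properties of thick subcategories *)

Section Thick.
Variables (R : pzRingType) (P : cplx R -> Prop) (thickP : @thick (Db R) P).
Implicit Types X Y Z W N : cplx R.

Lemma thick_cone X Y (f : cmap X Y) :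
  [/\ P X -> P Y -> P (cone f), P Y -> P (cone f) -> P X & P X -> P (cone f) -> P Y].
Proof. by have [[_ _ H] _] := thickP; apply: H (ddist_cone f). Qed.

(** Closure under isomorphism follows from triangles: with [A] the cone of the identity of [X],
    which is acyclic and in [P], an isomorphism [u] completes the zero map [A -> X] to a
    distinguished triangle. *)
Lemma thick_iso X Y : @iso (Db R) X Y -> P X -> P Y.
Proof.
move=> [u [v [vu uv]]] PX; have [H1 _ _] := thick_cone (cid X).
have PA := H1 PX PX; set A := cone (cid X) in PA.
have aA : acyc A by apply/acyc_cone/cid_quasi_iso.
have [[_ _ H] _] := thickP.
pose w : dmor Y (cone (czero A X)) := DComp (DMap (cone_in (czero A X))) v.
have I Z : @diso R Z Z (DMap (cid Z)).
  by exists (DMap (cid Z)); split; apply: deq_id_l.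
have D : @tdist (Db R) A X Y (DMap (czero A X)) u (DComp (DMap (cone_out (czero A X))) w).
  exists A, X, (czero A X), (DMap (cid A)), (DMap (cid X)), w; split; split.
  - exact: I.
  - exact: I.
  - apply: (@tiso_comp (Db R)); first by apply/qis_tiso/cone_in_qis.
    by exists u.
  - by rewrite deq_id_l deq_id_r; apply: deq_refl.
  - have {}vu : deq (DComp v u) (DMap (cid X)) by [].
    by rewrite -deq_assoc vu deq_id_r; apply: deq_refl.
  - have -> : deq (dshift 1 (DMap (cid A))) (DMap (cid (shift 1 A))) by apply: DMap_eq.
    by rewrite deq_id_l; apply: deq_refl.
by have [H2 _ _] := H _ _ _ _ _ _ D; apply: H2.
Qed.

Lemma thick_shift n X : P X -> P (shift n X).
Proof. by have [[_ H _] _] := thickP; apply: H. Qed.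

Lemma thick_comp X Y Z (a : cmap X Y) (b : cmap Y Z) :
  P (cone a) -> P (cone b) -> P (cone (ccomp b a)).
Proof.
move=> Pa Pb; have [_ _ H] := thick_cone (octa a b); apply: H => //.
exact: thick_iso (iso_sym (qis_iso (octa_out_qis a b))) Pb.
Qed.

(** Some [Z] lies in [P]; the cone of its identity is acyclic, hence isomorphic to [X] by the zero
    map. *)
Lemma thick_acyc X : acyc X -> P X.
Proof.
move=> aX; have [[[Z PZ] _ _] _] := thickP.
have [H _ _] := thick_cone (cid Z); apply: thick_iso (H PZ PZ).
apply: (qis_iso (s := czero _ _)); apply: acyc_qis => //.
exact/acyc_cone/cid_quasi_iso.
Qed.

(** After a quasi-isomorphism [t : W -> X] the map [a] becomes null-homotopic, so [shift 1 W] is a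
    summand of the cone of [a t], which lies in [P] along with [cone a]. *)
Lemma thick_null X Y (a : cmap X Y) :
  deq (DMap a) (DMap (czero X Y)) -> P (cone a) -> P X.
Proof.
move=> /deq_DMap[W [t [qt at0]]] Pa.
have Pat : P (cone (ccomp a t)) by apply: thick_comp => //; apply/thick_acyc/acyc_cone.
have /cone_null S : homotopic (ccomp a t) (czero W Y).
  by apply: homotopic_trans at0 _; apply: eq_homotopic.
have [_ H] := thickP; have PW : P (shift 1 W) by apply: H Pat; exists Y.
apply: thick_iso (qis_iso qt) _.
by apply: thick_iso (thick_shift (-1) PW); apply: (unshift_iso (-1)).
Qed.

End Thick.

(** * The thick subcategory of objects eventually orthogonal to a given one *)

Section Perpendicular.
Variables (R : pzRingType) (N : cplx R).
Implicit Types X Y Z W K : cplx R.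

(** Exactness of Hom(K, -) at [X]: a fraction killed by [f] has, after refinement, a numerator that
    lifts to the fibre. *)
Lemma hom_unique_fibre K X Y (f : cmap X Y) : @hom_unique (Db R) K (hfib f) ->
  @hom_unique (Db R) K Y -> @hom_unique (Db R) K X.
Proof.
move=> HF HY; apply/hom_trivialP => u.
have [W [s [qs [g ug]]]] := fraction u.
have /deq_DMap[V [t [qt fgt]]] : deq (DMap (ccomp f g)) (DMap (czero W Y)).
  apply: (deq_cancel_r (cid_quasi_iso W)); rewrite !deq_id_r.
  have -> : deq (DMap (ccomp f g)) (DComp (DComp (DComp (DMap f) (DMap g)) (DInv qs)) (DMap s)).
    by rewrite -!deq_assoc deq_inv_l deq_id_r deq_map_comp; apply: deq_refl.
  have -> : deq (DComp (DComp (DMap f) (DMap g)) (DInv qs)) (DMap (czero K Y)) by apply: HY.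
  exact: czero_comp.
have [|l lP] := @hlift_exists R X Y f V (ccomp g t) (czero V X).
  apply: (homotopic_trans (ccompA _ _ _)); apply: (homotopic_trans fgt).
  by apply: eq_homotopic => i x /=; rewrite linear0.
have gt : deq (DComp (DMap g) (DMap t)) (DComp (DMap (hout f)) (DMap l)).
  by rewrite -!deq_map_comp; apply: DMap_eq => i x; rewrite [RHS]lP subr0.
have ul : deq u (DComp (DMap (hout f)) (DComp (DMap l) (DComp (DInv qt) (DInv qs)))).
  by rewrite !deq_assoc -gt -(deq_assoc _ (DMap t)) deq_inv_r deq_id_r.
apply: deq_trans ul _.
have -> : deq (DComp (DMap l) (DComp (DInv qt) (DInv qs))) (DMap (czero _ _)) by apply: HF.
exact: comp_czero.
Qed.

Lemma perp_iso X Y : @iso (Db R) X Y -> perp N X -> perp N Y.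
Proof.
by move=> XY [n H]; exists n => i /H; apply: hom_unique_iso XY; apply: iso_refl.
Qed.

Lemma perp_shift n X : perp N X -> perp N (shift n X).
Proof.
move=> [m H]; exists (m + `|n|)%N => i mi; apply/hom_unique_shiftr.
apply: hom_unique_iso (H (i - n) _); [|exact: iso_refl|lia].
by apply: iso_sym; apply: shift_shift_iso.
Qed.

Lemma perp_add X Y Z : (forall K, @hom_unique (Db R) K X -> @hom_unique (Db R) K Y ->
  @hom_unique (Db R) K Z) -> perp N X -> perp N Y -> perp N Z.
Proof.
move=> H [m HX] [n' HY]; exists (maxn m n') => i; rewrite gtn_max => /andP[/HX ? /HY ?].
exact: H.
Qed.

Lemma perp_fibre X Y (f : cmap X Y) : perp N (cone f) -> perp N Y -> perp N X.
Proof.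
move=> /(perp_shift (-1)); apply: perp_add => K; exact: hom_unique_fibre.
Qed.

(** Rotation turns this case and [perp_cone] into instances of [perp_fibre]. *)
Lemma perp_total X Y (f : cmap X Y) : perp N X -> perp N (cone f) -> perp N Y.
Proof.
move=> PX PC; apply: (@perp_fibre _ _ (cone_in f)) PC.
exact: perp_iso (iso_sym (qis_iso (rot_qis f))) (perp_shift 1 PX).
Qed.

Lemma perp_cone X Y (f : cmap X Y) : perp N X -> perp N Y -> perp N (cone f).
Proof.
move=> PX PY; apply: (@perp_fibre _ _ (cone_in (cone_in f))).
  exact: perp_iso (iso_sym (qis_iso (rot_qis (cone_in f)))) (perp_shift 1 PY).
exact: perp_iso (iso_sym (qis_iso (rot_qis f))) (perp_shift 1 PX).
Qed.

Lemma perp_thick : @thick (Db R) (perp N).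
Proof.
split; last first.
  move=> X Z [Y [i [_ [p [_ [pi _ _ _ _]]]]]] [n H]; exists n => k nk u v.
  apply: teq_trans (teq_sym (tcomp1l u)) _; apply: teq_trans (tcomp1l v).
  (* Both [u = p i u] and [v = p i v], and [i u = i v] as morphisms into [Z] are unique. *)
  rewrite -pi -!tcompA; apply: teq_comp (teq_refl _) _.
  exact: H.
split.
- exists (cone (cid N)); exists 0%N => i _; apply: acyc_hom_unique_r.
  exact/acyc_cone/cid_quasi_iso.
- by move=> n X; apply: perp_shift.
move=> X Y Z a b c [X' [Y' [f [u [v [w [[du dv dw] _]]]]]]].
have XX : @iso (Db R) X X' by exists u.
have YY : @iso (Db R) Y Y' by exists v.
have ZZ : @iso (Db R) Z (cone f) by exists w.
split=> /(perp_iso _) p1 /(perp_iso _) p2.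
- by apply: (perp_iso (iso_sym ZZ)); apply: perp_cone; [apply: p1 | apply: p2].
- by apply: (perp_iso (iso_sym XX)); apply: (@perp_fibre _ _ f); [apply: p2 | apply: p1].
- by apply: (perp_iso (iso_sym YY)); apply: (@perp_total _ _ f); [apply: p1 | apply: p2].
Qed.

End Perpendicular.

(** * Perfect objects and derived equivalences *)

Section Spheres.
Variable R : pzRingType.
Implicit Types X Y Z W K : cplx R.

(** Being defined in every degree, it allows maps out of a shifted stalk to be given by one formula,
    without casts. *)
Definition stalk_coef (j : int) : stalk_ob R j -> R :=
  match j with Posz 0 => fun x => x | _ => fun=> 0 end.

Lemma stalk_coef_linear j (a : R) (u v : stalk_ob R j) :
  stalk_coef (a *: u + v) = a * stalk_coef u + stalk_coef v.
Proof. by case: j u v => [[|j]|j] u v //=; rewrite mulr0 addr0. Qed.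

Lemma stalk_coefZ j (a : R) (u : stalk_ob R j) :
  stalk_coef (a *: u) = a * stalk_coef u.
Proof. by case: j u => [[|j]|j] u //=; rewrite mulr0. Qed.

Lemma stalk_coef0 j : stalk_coef (0 : stalk_ob R j) = 0.
Proof. by case: j => [[|j]|j]. Qed.

Lemma stalk_coef_inj j : injective (@stalk_coef j).
Proof. by case: j => [[|j]|j] // u v _; apply/rowP => -[]. Qed.

Lemma stalk_coef_neq0 j (x : stalk_ob R j) : j != 0 -> stalk_coef x = 0.
Proof. by case: j x => [[|j]|j]. Qed.

Lemma stalk_one j : j = 0 -> exists e : stalk_ob R j, stalk_coef e = 1.
Proof. by move=> ->; exists 1. Qed.

Variable d : int.

(** The ring placed in cohomological degree [d]. *)
Definition sphere : cplx R := shift (- d) (stalk R).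

Lemma sphere_d i j (x : sphere i) : cdf sphere i j x = 0.
Proof. by rewrite /= /shift_d; case: odd; rewrite //= oppr0. Qed.

Lemma cyc_sphere i (x : sphere i) : cyc x.
Proof. by move=> j; apply: sphere_d. Qed.

Lemma bnd_sphere i (x : sphere i) : bnd x -> x = 0.
Proof. by move=> [j [y ->]]; apply: sphere_d. Qed.

Lemma sphere_coef0 i (x : sphere i) : i != d -> stalk_coef x = 0.
Proof. by move=> id; apply: stalk_coef_neq0; lia. Qed.

Lemma sphere_eq0 i (x : sphere i) : i != d -> x = 0.
Proof.
move=> id; apply: stalk_coef_inj; rewrite (sphere_coef0 x id).
by rewrite (@sphere_coef0 i 0 id).
Qed.

Section SphereMap.
Variables (X : cplx R) (x : X d) (cx : cyc x).

Lemma sphmap_linear i : linear (fun s : sphere i => stalk_coef s *: deg_id i x).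
Proof. by move=> a u v; rewrite /= stalk_coef_linear scalerDl scalerA. Qed.

Lemma sphmap_d i j (s : sphere i) : i + 1 = j ->
  lin (@sphmap_linear j) (cdf sphere i j s) = cdf X i j (lin (@sphmap_linear i) s).
Proof.
move=> _; rewrite sphere_d linear0 /= linearZ /=.
have [di|di] := eqVneq d i; last by rewrite deg_id_neq // linear0 scaler0.
have H : cyc (deg_id i x) by apply/cyc_deg.
by rewrite H scaler0.
Qed.

Definition sphmap : cmap sphere X := @cmap_of R sphere X (fun i => lin (@sphmap_linear i)) sphmap_d.

End SphereMap.

Lemma sphere_unit W (s : cmap W sphere) : quasi_iso s ->
  exists w : W d, cyc w /\ stalk_coef (s d w) = 1.
Proof.
move=> qs; have [|e e1] := @stalk_one (d - d); first by rewrite subrr.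
have [w [cw /bnd_sphere we]] := qisS qs (cyc_sphere (e : sphere d)).
exists w; split=> //; rewrite -e1; congr stalk_coef; exact: subr0_eq.
Qed.

Lemma sphmap_null X (x : X d) (cx : cyc x) : bnd x ->
  homotopic (sphmap cx) (czero sphere X).
Proof.
case/(bndP (j := d - 1)) => [|y xy]; first by lia.
have hl i j : linear (fun s : sphere i => stalk_coef s *: deg_id j y).
  by move=> a u v; rewrite /= stalk_coef_linear scalerDl scalerA.
exists (fun i j => lin (@hl i j)) => i s.
rewrite sphere_d !linear0 !addr0 /= linearZ /= xy; congr (_ *: _).
have [di|di] := eqVneq d i; first by rewrite (deg_id_d (j := d)) ?di.
by rewrite !deg_id_neq ?linear0 //; lia.
Qed.

(** Both sides express H^d(X) = 0, since morphisms from [sphere] to [X] are given by classes in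
    H^d(X). *)
Lemma sphereP X : @hom_unique (Db R) sphere X <-> acyc_at X d.
Proof.
split=> [H x cx|aX].
  have /deq_DMap[W [t [qt h]]] : deq (DMap (sphmap cx)) (DMap (czero _ _)) by apply: H.
  have [w [cw w1]] := sphere_unit qt; have := homotopic_bnd h cw.
  by rewrite /= w1 scale1r deg_idE subr0.
apply/hom_trivialP => u; have [W [s [qs [g ug]]]] := fraction u.
have [w [cw w1]] := sphere_unit qs.
(* Freeness of the ring: a cycle [w] lifting 1 defines a section of [s], which then represents the
   inverse of [s]. *)
have sw : deq (DComp (DMap s) (DMap (sphmap cw))) (DMap (cid _)).
  rewrite -deq_map_comp; apply: DMap_eq => i x; apply: stalk_coef_inj => /=.
  rewrite linearZ stalk_coefZ; have [di|di] := eqVneq d i.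
    by subst i; rewrite /= deg_idE w1 mulr1.
  by rewrite deg_id_neq // linear0 !sphere_coef0 ?mul0r // eq_sym.
have st : deq (DInv qs) (DMap (sphmap cw)).
  by rewrite -(deq_id_r (DInv _)) -sw deq_assoc deq_inv_l deq_id_l; apply: deq_refl.
apply: deq_trans ug _; rewrite st -deq_map_comp.
apply: (@deq_trans _ _ _ _ (DMap (sphmap (cyc_map g cw)))).
  by apply: DMap_eq => i x /=; rewrite linearZ /= deg_id_map.
exact/DMap_hom/sphmap_null/aX/cyc_map.
Qed.

End Spheres.

(** * Killing top cohomology by perfect complexes *)

Section Approximation.
Variables (R : pzRingType) (noethR : left_noetherian R).
Variables (P : cplx R -> Prop) (thickP : @thick (Db R) P) (Pstalk : P (stalk R)).
Implicit Types X Y Z W K : cplx R.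

(** Induction on the generators of H^d: coning off the map [sphere d -> X] given by the first one
    makes it a boundary, and the others still generate. *)
Lemma kill_homology d n X (g : 'I_n -> X d) : aisle d X ->
  (forall i, cyc (g i)) ->
  (forall x : X d, cyc x -> exists c, bnd (x - \sum_i c i *: g i)) ->
  exists X' (a : cmap X X'), P (cone a) /\ aisle (d - 1) X'.
Proof.
elim: n X g => [|n IHn] X g aX cg gP.
  exists X, (cid X); split; first exact/(thick_acyc thickP)/acyc_cone/cid_quasi_iso.
  move=> i di; have [e|id] := eqVneq i d; last by apply: aX; lia.
  by subst i => x /gP[c]; rewrite big_ord0 subr0.
(* By rotation this cone is a shift of the sphere, hence of the stalk complex. *)
set q := sphmap (cg ord0); have Pq : P (cone (cone_in q)).
  apply: (thick_iso thickP (iso_sym (qis_iso (rot_qis q)))).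
  exact/(thick_shift thickP)/(thick_shift thickP).
have aq : aisle d (cone q).
  move=> i di; apply: acyc_at_cone => [x _ _|y cy].
    by apply/bnd_eq/sphere_eq0; lia.
  exists 0; split; first exact: cyc0.
  by rewrite linear0 sub0r; apply/bndN/aX.
have [||X' [a [Pa aX']]] := IHn (cone q) (fun i => cone_in q d (g (lift ord0 i))) aq.
- by move=> i; apply: cyc_map.
- move=> [s y] cz; have s0 : s = 0 by apply: sphere_eq0; lia.
  subst s; have [|c /(bnd_map (cone_in q)) bc] := gP y.
    have /= := cz (d + 1); rewrite /cone_d /= !deg_idE => -[_].
    by rewrite stalk_coef0 scale0r add0r; apply: cycP.
  exists (fun i => c (lift ord0 i)).
  (* The element [(1, 0)] of degree [d - 1] in the cone has the first generator as its boundary. *)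
  have bg : bnd (cone_in q d (g ord0)).
    have [|e e1] := @stalk_one R (d - 1 + 1 - d); first by lia.
    exists (d - 1), (e, 0); rewrite /= /cone_d /=; congr (_, _) => /=.
      by rewrite sphere_d oppr0.
    by rewrite e1 scale1r deg_idK ?linear0 ?addr0 //; lia.
  have := bndD bc (bndZ (c ord0) bg).
  rewrite big_ord_recl linearB linearD linear_sum linearZ.
  under eq_bigr do rewrite linearZ.
  congr bnd; zmod.
exists X', (ccomp a (cone_in q)); split=> //; exact: (thick_comp thickP).
Qed.

Lemma approximate n d X : aisle d X ->
  exists X' (a : cmap X X'), P (cone a) /\ aisle (d - n%:Z) X'.
Proof.
move=> aX; elim: n => [|n [X' [a [Pa aX']]]].
  exists X, (cid X); split; last by rewrite subr0.
  exact/(thick_acyc thickP)/acyc_cone/cid_quasi_iso.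
have [k [g gP]] := cob_fg X' (d - n%:Z).
have [|||m [h [hc hP]]] := @noetherian_span R _ k g cyc noethR.
- exact: cyc0.
- by move=> c x y cx cy j; rewrite linearP /= cx cy scaler0 addr0.
- by move=> x _; apply: gP.
have [|X'' [b [Pb aX'']]] := kill_homology aX' hc.
  by move=> x /hP[c xc]; exists c; rewrite -xc subrr; apply: bnd0.
exists X'', (ccomp b a); split; first exact: (thick_comp thickP).
by have -> : d - n.+1%:Z = d - n%:Z - 1 by lia.
Qed.

Lemma aisle_exists X : exists k : int, aisle k X.
Proof.
have [n H] := cob_bounded X; exists n%:Z => i ni x _; apply/bnd_eq/H; lia.
Qed.

(** An approximation of [U] in D^{<=m} is a zero map by hypothesis and has its cone in [P], so
    [thick_null] applies. *)
Lemma thick_of_orth U m :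
  (forall Z, aisle m Z -> @hom_unique (Db R) U Z) -> P U.
Proof.
move=> H; have [k aU] := aisle_exists U.
(* The absolute value ensures that [k] minus it is at most [m], whichever of the two is larger. *)
have [X' [a [Pa aX']]] := approximate `|k - m|%N aU.
apply: (thick_null thickP _ Pa); apply: H => i mi; apply: aX'; lia.
Qed.

End Approximation.

Lemma Thick_thick (T : tricat) (G : T) : thick (Thick G).
Proof.
split; last by move=> X Z XZ GZ P tP PG; have [_ H] := tP; apply: H XZ (GZ P tP PG).
split.
- by exists G => P.
- by move=> n X GX P tP PG; have [[_ H _] _] := tP; exact: H (GX P tP PG).
- move=> X Y Z a b c D; split=> GX GY P tP PG;
    have [[_ _ H] _] := tP; have [H1 H2 H3] := H _ _ _ _ _ _ D.
  + exact: H1 (GX P tP PG) (GY P tP PG).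
  + exact: H2 (GX P tP PG) (GY P tP PG).
  + exact: H3 (GX P tP PG) (GY P tP PG).
Qed.

(** * Transfer of perfect objects along a derived equivalence *)

Section DerivedEquivalence.
Variables (R S : pzRingType).
Hypotheses (noethR : left_noetherian R) (noethS : left_noetherian S).
Variables (F : tfunctor (Db R) (Db S)) (G : tfunctor (Db S) (Db R)).
Hypotheses (triF : triangulated_functor F).
Hypotheses (GF : nat_iso (compfunctor G F) (idfunctor (Db R)))
  (FG : nat_iso (compfunctor F G) (idfunctor (Db S))).

(** A triangulated functor comes with the comparison for the shift by 1 only; natural shifts follow
    by induction and negative ones by inversion. *)
Lemma functor_shift n (X : Db R) : iso (F (shift n X : Db R)) (shift n (F X) : Db S).
Proof.
have F1 (Y : Db R) : iso (F (shift 1 Y : Db R)) (shift 1 (F Y) : Db S).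
  by have [_ [t [tI _ _]]] := triF; exists (t Y); apply: tI.
have Fn (k : nat) (Y : Db R) : iso (F (shift k%:Z Y : Db R)) (shift k%:Z (F Y) : Db S).
  elim: k => [|k IHk].
    apply: iso_trans (iso_functor F (shift0_iso Y)) _.
    exact/iso_sym/shift0_iso.
  apply: iso_trans (iso_functor F _) _.
    by apply: iso_sym; apply: (@shift_shift_iso _ 1 k%:Z); rewrite addrC.
  apply: iso_trans (F1 _) _; apply: iso_trans (shift_iso 1 IHk) _.
  by apply: shift_shift_iso; rewrite -addn1.
case: n => k; first exact: Fn.
have -> : Negz k = - k.+1%:Z by [].
set m := k.+1%:Z.
have U := unshift_iso (- m) (F (shift (- m) X : Db R)); rewrite opprK in U.
apply: iso_trans (iso_sym U) _.
apply: shift_iso; apply: iso_trans (iso_sym (Fn k.+1 _)) _.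
exact/iso_functor/unshift_iso.
Qed.

(** H^i(F X) is the group of morphisms from [G (stalk S)], in D^{<=k}, to [shift i X], which lies in
    D^{>k} for [i <= m]. *)
Lemma coaisle_functor k m (X : Db R) : aisle k (G (stalk S : Db S)) ->
  coaisle (m + k) X -> coaisle m (F X).
Proof.
move=> aT cX i im; apply/sphereP; apply/hom_unique_shiftr.
apply: (hom_unique_iso (iso_FG FG _) (functor_shift i X)).
apply/(hom_unique_functor GF FG); apply: (aisle_coaisle noethR aT).
by move=> j jk; apply/acyc_at_shift/cX; lia.
Qed.

(** D^{<=m+k} is detected by orthogonality to D^{>m+k}, which [F] maps into D^{>m}. *)
Lemma aisle_functor_inv k m (Z : Db S) : aisle k (G (stalk S : Db S)) ->
  aisle m Z -> aisle (m + k) (G Z).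
Proof.
move=> aT aZ; apply: (aisle_of_orth noethR) => X cX.
apply/(hom_unique_functor GF FG).
apply: (hom_unique_iso (iso_sym (iso_FG FG Z)) (iso_refl (F X))).
exact: (aisle_coaisle noethS aZ (coaisle_functor aT cX)).
Qed.

Lemma functor_stalk_perfect : Thick (stalk S : Db S) (F (stalk R : Db R)).
Proof.
have [k aT] := aisle_exists (G (stalk S : Db S)).
(* The bound [- k - 1] puts [G Z] in D^{<=-1}, so that H^0(G Z), the group of morphisms from the
   stalk to [G Z], vanishes. *)
apply: (@thick_of_orth S noethS _ (@Thick_thick (Db S) (stalk S)) _ _ (- k - 1)).
  by move=> P.
move=> Z /(aisle_functor_inv aT) aGZ.
apply: (hom_unique_iso (iso_refl _) (iso_FG FG Z)).
apply/(hom_unique_functor GF FG).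
apply: (hom_unique_iso (shift0_iso (stalk R)) (iso_refl _)).
by apply/(sphereP 0)/aGZ; lia.
Qed.

(** A zero map factors through an acyclic [A], and [F A] has a single endomorphism, so its identity
    is zero. *)
Lemma functor_zero (X Y : Db R) : fmap F (tzero X Y) =~ tzero (F X) (F Y).
Proof.
pose A := cone (cid X).
have aA : acyc A by apply/acyc_cone/cid_quasi_iso.
have e : tzero X Y =~ (tzero (A : Db R) Y) \o (tzero X (A : Db R)).
  by apply/deq_sym/comp_czero.
apply: teq_trans (fmap_eq F e) _; rewrite fmap_comp.
apply: teq_trans (teq_comp (teq_refl _) (teq_sym (tcomp1l _))) _.
have : hom_unique (F A) (F A).
  exact/(hom_unique_functor GF FG)/acyc_hom_unique_l.
move/(_ (tid _) (tzero _ _)) => ->.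
apply: teq_trans (teq_comp (teq_refl _) _) _; first exact: czero_comp.
exact: comp_czero.
Qed.

(** The objects that [F] sends into the thick closure of [stalk S] form a thick subcategory
    containing [stalk R]. *)
Lemma functor_Thick (X : Db R) : Thick (stalk R : Db R) X -> Thick (stalk S : Db S) (F X).
Proof.
have tS := @Thick_thick (Db S) (stalk S).
move/(_ (fun Y : Db R => Thick (stalk S : Db S) (F Y))).
apply; last exact: functor_stalk_perfect.
have [addF [t [tI tN tD]]] := triF.
split; last first.
  move=> X1 Z [Y [iX [iY [pX [pY [e1 e2 e3 e4 e5]]]]]]; have [_ H] := tS; apply: H.
  exists (F Y), (fmap F iX), (fmap F iY), (fmap F pX), (fmap F pY); split.
  - by rewrite -fmap_comp e1 fmap_id; apply: teq_refl.
  - by rewrite -fmap_comp e2 fmap_id; apply: teq_refl.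
  - by rewrite -fmap_comp e3; apply: functor_zero.
  - by rewrite -fmap_comp e4; apply: functor_zero.
  - rewrite -fmap_id; apply: teq_trans (fmap_eq F e5).
    apply: teq_trans (teq_sym (addF _ _ _ _)).
    by apply: dadd_deq; apply: deq_sym; apply: (fmap_comp F).
split.
- by exists (stalk R : Db R); apply: functor_stalk_perfect.
- move=> n Y /(thick_shift tS n); apply: (thick_iso tS); exact/iso_sym/functor_shift.
- by move=> X1 Y Z a b c /tD; have [[_ _ H] _] := tS; apply: H.
Qed.

End DerivedEquivalence.

Theorem theorem3p5 (R S : pzRingType)
  (noethR : left_noetherian R) (noethS : left_noetherian S)
  (RS : derived_equivalent R S)
  (hR : forall M : Db R, ev_orth M M -> ev_orth M (stalk R : Db R) ->
    Thick (stalk R : Db R) M) :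
  forall N : Db S, ev_orth N N -> ev_orth N (stalk S : Db S) ->
    Thick (stalk S : Db S) N.
Proof.
have [F [triF [G [GF FG]]]] := RS => N NN NS.
(* The objects to which [N] is eventually orthogonal form one of the thick subcategories over which
   [Thick] quantifies. *)
have NU : ev_orth N (F (stalk R : Db R)).
  apply/ev_orthP; apply: (functor_stalk_perfect noethR noethS triF GF FG).
    exact: perp_thick.
  exact/ev_orthP.
have FM := iso_FG FG N; set M := G N in FM.
(* [F] reflects vanishing of morphisms and commutes with shifts up to isomorphism, and [N] is
   isomorphic to [F M]. *)
have orthM (X : Db R) : ev_orth N (F X) -> ev_orth M X.
  move=> [n H]; exists n => i /H/hom_trivialP u; apply/hom_trivialP.
  apply/(hom_unique_functor GF FG); move: u.
  by apply: hom_unique_iso; [apply: iso_sym | apply/iso_sym/functor_shift].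
have MM : ev_orth M M.
  apply: orthM; case: NN => n H; exists n => i /H/hom_trivialP u; apply/hom_trivialP.
  by apply: hom_unique_iso u; [apply: iso_refl | apply/shift_iso/iso_sym].
have := functor_Thick noethR noethS triF GF FG (hR M MM (orthM _ NU)).
exact: (thick_iso (@Thick_thick (Db S) (stalk S)) FM).
Qed.
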